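(* Let $F$ and $G$ be two formal groups over $\mathcal{O}_K$. If $\mathrm{Tors}(F) \cap \mathrm{Tors}(G)$ is infinite, then $F = G$ (that is, $F(X,Y) = G(X,Y)$ as power series in $\mathcal{O}_K[[X,Y]]$).
   Context: Let $p$ be a prime and let $K$ be a finite extension of $\mathbf{Q}_p$ or, more generally, a finite extension of $W(k)[1/p]$, where $k$ is a perfect field of characteristic $p$ and $W(k)$ is its ring of Witt vectors. Let $\mathcal{O}_K$ be the ring of integers of $K$, let $\overline{K}$ be an algebraic closure of $K$, let $\mathbf{C}_p$ be the $p$-adic completion of $\overline{K}$, and let $\mathfrak{m}_{\mathbf{C}_p} = \{ z \in \mathbf{C}_p : |z|_p < 1 \}$. A formal group over $\mathcal{O}_K$ means a one-dimensional (commutative) formal group law $F(X,Y) = X \oplus Y \in \mathcal{O}_K[[X,Y]]$. It makes $\mathfrak{m}_{\mathbf{C}_p}$ into an abelian group under $(x,y) \mapsto F(x,y)$, and $\mathrm{Tors}(F) \subset \mathfrak{m}_{\mathbf{C}_p}$ denotes the set of torsion elements of this group. *)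

(* Defs.v *)
From HB Require Import structures.
From mathcomp Require Import all_boot all_order all_algebra all_field.
From mathcomp Require Import boolp classical_sets cardinality reals.
(* mpoly is imported in one section only: its notations clash with those of the
   topology files of MathComp-Analysis. *)
From mathcomp Require mpoly.

Set Implicit Arguments.
Unset Strict Implicit.
Unset Printing Implicit Defensive.

Import Order.TTheory GRing.Theory Num.Theory.
Local Open Scope classical_set_scope.
Local Open Scope ring_scope.

Definition perfect_of_char (p : nat) (k : fieldType) : Prop :=
  p \in [pchar k] /\ forall x : k, exists y : k, y ^+ p = x.

(* The m-th ghost component w_m(x) = \sum_(i <= m) p^i x_i^(p^(m-i)). *)
Definition ghost (p : nat) (A : comNzRingType) (x : nat -> A) (m : nat) : A :=
  \sum_(i < m.+1) (p ^ i)%:R * x i ^+ (p ^ (m - i)).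

Section WittPolynomials.
Import mpoly.

(* Polynomials over Z in the variables X_0, ..., X_n, Y_0, ..., Y_n. *)
Definition witt_poly (n : nat) : comNzRingType := {mpoly int[n.+1 + n.+1]}.

(* inord makes these meaningful for i <= n only. *)
Definition wittX (n i : nat) : witt_poly n := 'X_(lshift n.+1 (inord i)).
Definition wittY (n i : nat) : witt_poly n := 'X_(rshift n.+1 (inord i)).

Definition witt_eval (A : comNzRingType) (n : nat) (x y : nat -> A)
    (P : witt_poly n) : A :=
  mmap (fun z : int => z%:~R)
    (fun j => match split j with inl i => x i | inr i => y i end) P.

End WittPolynomials.

(* W, with coordinates c : W -> k^N, is the ring of Witt vectors W(k): its
   operations are given in coordinates by the polynomials S_0, S_1, ... and
   P_0, P_1, ... over Z determined by
     w_m(S) = w_m(X) + w_m(Y)   and   w_m(P) = w_m(X) * w_m(Y).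
   The m-th equation only involves indices <= m, so the n-th polynomial is
   determined by the equations for m <= n. *)
Record is_witt_ring (p : nat) (k : fieldType) (W : comNzRingType)
    (c : W -> nat -> k) : Prop := IsWittRing {
  witt_coord_bij : bijective c ;
  witt_coordD : forall (n : nat) (a b : W),
    exists S : nat -> witt_poly n,
      (forall m, (m <= n)%N ->
         ghost p S m = ghost p (wittX n) m + ghost p (wittY n) m)
      /\ c (a + b) n = witt_eval (c a) (c b) (S n) ;
  witt_coordM : forall (n : nat) (a b : W),
    exists P : nat -> witt_poly n,
      (forall m, (m <= n)%N ->
         ghost p P m = ghost p (wittX n) m * ghost p (wittY n) m)
      /\ c (a * b) n = witt_eval (c a) (c b) (P n)
}.

(* K0 = W[1/p]; the localization map is injective as W has no p-torsion. *)
Definition is_invert_p (p : nat) (W : comNzRingType) (K0 : fieldType)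
    (iota : W -> K0) : Prop :=
  injective iota /\
  forall x : K0, exists (w : W) (n : nat), x = iota w / p%:R ^+ n.

Section AbsoluteValue.
Variables (R : realType) (C : fieldType) (abs : C -> R).

Record is_nonarch_abs : Prop := IsNonarchAbs {
  abs_ge0 : forall x, 0 <= abs x ;
  abs_eq0 : forall x, abs x = 0 <-> x = 0 ;
  absM : forall x y, abs (x * y) = abs x * abs y ;
  abs_ultra : forall x y, abs (x + y) <= Num.max (abs x) (abs y)
}.

Definition abs_cvg (u : nat -> C) (l : C) : Prop :=
  forall e : R, 0 < e ->
    exists N : nat, forall n, (N <= n)%N -> abs (u n - l) < e.

Definition abs_cauchy (u : nat -> C) : Prop :=
  forall e : R, 0 < e ->
    exists N : nat, forall m n, (N <= m)%N -> (N <= n)%N -> abs (u m - u n) < e.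

Definition abs_complete : Prop :=
  forall u, abs_cauchy u -> exists l, abs_cvg u l.

Definition maxideal : set C := [set z | abs z < 1].

End AbsoluteValue.

Definition is_algebraic_closure (K : fieldType) (Kbar : closedFieldType)
    (j : K -> Kbar) : Prop :=
  forall z : Kbar, algebraicOver j z.

(* C, with the absolute value abs, is the completion (along h) of Kbar for the
   absolute value extending the p-adic one of W; f is the map from W to C. *)
Record is_padic_completion (p : nat) (R : realType) (W : comNzRingType)
    (Kbar C : fieldType) (f : W -> C) (h : Kbar -> C) (abs : C -> R) : Prop :=
  IsPadicCompletion {
  completion_abs : is_nonarch_abs abs ;
  completion_padic : forall (n : nat) (w : W),
    ~ (exists v : W, w = p%:R * v) -> abs (f (p%:R ^+ n * w)) = p%:R ^- n ;
  completion_dense : forall (z : C) (e : R), 0 < e ->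
    exists x : Kbar, abs (z - h x) < e ;
  completion_complete : abs_complete abs
}.

(* F i j is the coefficient of X^i Y^j. *)
Definition series2 (A : Type) : Type := nat -> nat -> A.

(* u a b c is the coefficient of X^a Y^b Z^c. *)
Definition series3 (A : Type) : Type := nat -> nat -> nat -> A.

Section PowerSeries.
Variable A : comNzRingType.

Definition mul3 (u v : series3 A) : series3 A := fun a b c =>
  \sum_(i < a.+1) \sum_(j < b.+1) \sum_(l < c.+1)
    u i j l * v (a - i)%N (b - j)%N (c - l)%N.

Definition one3 : series3 A := fun a b c => [&& a == 0, b == 0 & c == 0]%N%:R.

Definition exp3 (u : series3 A) (n : nat) : series3 A := iter n (mul3 u) one3.

(* F(u, v) for u and v without constant term: then u^i v^j has no term of
   degree < i + j, so i, j <= a + b + c suffices for the coefficient of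
   X^a Y^b Z^c. *)
Definition subst3 (F : series2 A) (u v : series3 A) : series3 A := fun a b c =>
  \sum_(i < (a + b + c).+1) \sum_(j < (a + b + c).+1)
    F i j * mul3 (exp3 u i) (exp3 v j) a b c.

Definition serX : series3 A := fun a b c => [&& a == 1, b == 0 & c == 0]%N%:R.
Definition serZ : series3 A := fun a b c => [&& a == 0, b == 0 & c == 1]%N%:R.
Definition inXY (F : series2 A) : series3 A := fun a b c => F a b *+ (c == 0%N).
Definition inYZ (F : series2 A) : series3 A := fun a b c => F b c *+ (a == 0%N).

Record is_formal_group_law (F : series2 A) : Prop := IsFormalGroupLaw {
  fgl_X0 : forall i, F i 0%N = (i == 1%N)%:R ;
  fgl_0Y : forall j, F 0%N j = (j == 1%N)%:R ;
  fgl_comm : forall i j, F i j = F j i ;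
  fgl_assoc : forall a b c,
    subst3 F (inXY F) serZ a b c = subst3 F serX (inYZ F) a b c
}.

End PowerSeries.

Section FormalGroup.
Variables (R : realType) (K C : fieldType) (emb : K -> C) (abs : C -> R).

Definition integers : set K := [set x | abs (emb x) <= 1].

Definition is_formal_group (F : series2 K) : Prop :=
  (forall i j, integers (F i j)) /\ is_formal_group_law F.

(* The sum of F at (x, y), with junk value 0 when the series diverges. *)
Definition series2_eval (F : series2 K) (x y : C) : C :=
  xget 0 [set z | abs_cvg abs
    (fun n => \sum_(i < n) \sum_(j < n) emb (F i j) * x ^+ i * y ^+ j) z].

Definition fg_mul (F : series2 K) (n : nat) (x : C) : C :=
  iter n (series2_eval F x) 0.

Definition Tors (F : series2 K) : set C :=
  [set x | maxideal abs x /\ exists n : nat, (0 < n)%N /\ fg_mul F n x = 0].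

End FormalGroup.

(* Main.v *)
(** Let S be the set of common torsion points and let K1 be the closure of K in
    C_p, a complete discretely valued field. By Weierstrass preparation, a nonzero
    bounded power series over K1 has finitely many zeros in the open unit disc, and
    the K1-conjugates of a point of S lie in S and have the same order. If z in S
    has exact F-order p^(n+1), then log(1/|z|) is of size q^(-n), where q is p to
    the height of F, whereas the product of the conjugates of z is a non-unit of
    K1: so z has at least c q^n conjugates, among the at most q^(n+1) points of
    F[p^(n+1)]. By counting sums of a conjugate of z and a point of F[p^e], one
    finds, for e large and fixed, infinitely many z in S for which z +_F u is in S
    for some u in F[p^e] outside of a given finite set. Write
    z +_F u = z +_G v; then |v| = |u|, so that v too lies in a finite set, and the
    same pair (u, v) occurs for infinitely many z. The series F(Y, u) - G(Y, v),
    whose coefficients have discrete absolute values, thus has infinitely many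
    zeros and vanishes; Y = 0 gives u = v. Hence F(Y, u) = G(Y, u) for infinitely
    many u, and for each j the coefficient of Y^j in F(Y, X) - G(Y, X) is a bounded
    series in X with infinitely many zeros. *)

Require Import Defs.
From HB Require Import structures.
From mathcomp Require Import all_boot all_order all_algebra all_field.
From mathcomp Require Import boolp classical_sets cardinality reals.
From mathcomp Require Import zify ring lra.

Set Implicit Arguments.
Unset Strict Implicit.
Unset Printing Implicit Defensive.

Import Order.TTheory GRing.Theory Num.Theory.
Local Open Scope classical_set_scope.
Local Open Scope ring_scope.

(** * Non-archimedean absolute values *)

(** A bounded series over C_p may have no coefficient of maximal absolute value, and can then have
    infinitely many zeros in the disc; so discreteness has to be carried along. It is encoded by one
    constant w < 1 such that no absolute value of K1 lies strictly between w and 1. One starts with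
    1/p on W(k)[1/p], enlarges it when passing to K, and keeps it for K1, since a nonzero limit has
    the absolute value of its close approximations. For F(Y, u) - G(Y, v) no valued field K1(u, v)
    is built: the coefficients are limits of elements of the K1-space K1[u] + K1[v], and a linear
    relation among elements of distinct sizes forces the ratio of two of these sizes to be an
    absolute value of K1. No Galois group acts either: the conjugates of z are the roots of its
    minimal polynomial over K1, which divides the Weierstrass polynomials of the multiplication
    series that vanish at z. This only asks for monic integral polynomials to split in C_p. The
    counting works because q^(n+1) exceeds the number of conjugates by at most a constant factor,
    whereas F[p^e] can be made as large as desired. *)

Section Abs.
Variables (R : realType) (C : fieldType) (abs : C -> R).
Hypothesis Habs : is_nonarch_abs abs.

Lemma absE0 : abs 0 = 0.
Proof. exact/(abs_eq0 Habs). Qed.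

Lemma abs_eq0b x : (abs x == 0) = (x == 0).
Proof. by apply/eqP/eqP => /(abs_eq0 Habs). Qed.

Lemma abs_gt0 x : (0 < abs x) = (x != 0).
Proof. by rewrite lt0r abs_eq0b (abs_ge0 Habs) andbT. Qed.

Lemma abs1 : abs 1 = 1.
Proof.
have h : abs 1 != 0 by rewrite abs_eq0b oner_neq0.
by apply: (mulfI h); rewrite -(absM Habs) !mulr1.
Qed.

Lemma absN x : abs (- x) = abs x.
Proof.
suff h : abs (-1) = 1 by rewrite -mulN1r (absM Habs) h mul1r.
have : abs (-1) ^+ 2 == 1 by rewrite expr2 -(absM Habs) mulrNN mulr1 abs1.
by rewrite sqrp_eq1 ?(abs_ge0 Habs)// => /eqP.
Qed.

Lemma absX x n : abs (x ^+ n) = abs x ^+ n.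
Proof.
by elim: n => [|n ih]; rewrite ?expr0 ?abs1// !exprS (absM Habs) ih.
Qed.

Lemma absV x : abs x^-1 = (abs x)^-1.
Proof.
have [->|x0] := eqVneq x 0; first by rewrite !(invr0, absE0).
have h : abs x != 0 by rewrite abs_eq0b.
by apply: (mulfI h); rewrite -(absM Habs) !divff ?abs1.
Qed.

Lemma absB x y : abs (x - y) = abs (y - x).
Proof. by rewrite -opprB absN. Qed.

Lemma absD_le m x y : abs x <= m -> abs y <= m -> abs (x + y) <= m.
Proof.
by move=> hx hy; apply: le_trans (abs_ultra Habs x y) _; rewrite ge_max hx.
Qed.

Lemma absD_lt m x y : abs x < m -> abs y < m -> abs (x + y) < m.
Proof.
by move=> hx hy; apply: le_lt_trans (abs_ultra Habs x y) _; rewrite gt_max hx.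
Qed.

Lemma absB_le m x y : abs x <= m -> abs y <= m -> abs (x - y) <= m.
Proof. by move=> hx hy; apply: absD_le => //; rewrite absN. Qed.

Lemma absB_lt m x y : abs x < m -> abs y < m -> abs (x - y) < m.
Proof. by move=> hx hy; apply: absD_lt => //; rewrite absN. Qed.

Lemma abs_dist_le m x y z : abs (x - y) <= m -> abs (y - z) <= m ->
  abs (x - z) <= m.
Proof. by move=> h1 h2; rewrite -(subrKA y) ; apply: absD_le. Qed.

Lemma absD_dom x y : abs y < abs x -> abs (x + y) = abs x.
Proof.
move=> h; apply/eqP; rewrite eq_le absD_le ?(ltW h) //=.
case: (leP (abs x) (abs (x + y))) => // h2; have := absB_lt h2 h.
by rewrite addrK ltxx.
Qed.

Lemma abs_close_eq x y : abs (x - y) < abs x -> abs y = abs x.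
Proof. by move=> h; rewrite -[y](subKr x) absD_dom ?absN. Qed.

Lemma abs_sum_le (I : Type) (s : seq I) (P : pred I) (f : I -> C) m :
  0 <= m -> (forall i, P i -> abs (f i) <= m) ->
  abs (\sum_(i <- s | P i) f i) <= m.
Proof.
move=> m0 h; elim/big_rec: _ => [|i x Pi hx]; first by rewrite absE0.
exact: absD_le (h _ Pi) hx.
Qed.

Lemma absM_le1 x y : abs x <= 1 -> abs y <= 1 -> abs (x * y) <= 1.
Proof. by move=> hx hy; rewrite (absM Habs) mulr_ile1 ?(abs_ge0 Habs). Qed.

Lemma absM_le x y m : abs x <= 1 -> abs y <= m -> abs (x * y) <= m.
Proof.
move=> hx hy; rewrite (absM Habs); apply: le_trans hy.
by rewrite ler_piMl ?(abs_ge0 Habs).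
Qed.

Lemma absM_le_r x y m : abs x <= m -> abs y <= 1 -> abs (x * y) <= m.
Proof. by rewrite mulrC => hx hy; apply: absM_le. Qed.

Lemma absX_le1 x n : abs x <= 1 -> abs (x ^+ n) <= 1.
Proof. by move=> hx; rewrite absX exprn_ile1 ?(abs_ge0 Habs). Qed.

Lemma abs_prod (I : Type) (s : seq I) (f : I -> C) :
  abs (\prod_(i <- s) f i) = \prod_(i <- s) abs (f i).
Proof.
by elim: s => [|i s ih]; rewrite ?big_nil ?abs1// !big_cons (absM Habs) ih.
Qed.

Lemma abs_nat_le1 n : abs n%:R <= 1.
Proof.
elim: n => [|n ih]; first by rewrite absE0.
by rewrite -natr1; apply: absD_le; rewrite ?abs1.
Qed.

End Abs.

(* Bernoulli: (1 + e)^n >= 1 + n e. *)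
Lemma exp_unbounded (R : realType) (b m : R) : 1 < b -> exists n, m < b ^+ n.
Proof.
move=> b1; have e0 : 0 < b - 1 by rewrite subr_gt0.
have bern n : 1 + n%:R * (b - 1) <= b ^+ n.
  elim: n => [|n ih]; first by rewrite mul0r addr0 expr0.
  rewrite exprS; have : b * (1 + n%:R * (b - 1)) <= b * b ^+ n.
    by rewrite ler_pM2l// (lt_trans ltr01).
  apply: le_trans; rewrite -natr1.
  have : 0 <= n%:R * ((b - 1) * (b - 1)) by rewrite mulr_ge0 ?ler0n ?mulr_ge0 ?ltW.
  move: (n%:R : R) => k; nra.
exists (Num.Def.archi_bound `|m / (b - 1)|).
apply: lt_le_trans (bern _).
have := archi_boundP (x := `|m / (b - 1)|) (normr_ge0 _).
move=> h; have := le_lt_trans (ler_norm _) h.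
by rewrite ltr_pdivrMr// => h'; apply: lt_trans h' _; rewrite ltrDr ltr01.
Qed.

Lemma exp_small (R : realType) (r e : R) : 0 <= r -> r < 1 -> 0 < e ->
  exists n, r ^+ n < e.
Proof.
move=> r0 r1 e0; have [->|rn0] := eqVneq r 0; first by exists 1%N; rewrite expr1.
have rp : 0 < r by rewrite lt0r rn0.
have [n hn] : exists n, e^-1 < r^-1 ^+ n.
  by apply: exp_unbounded; rewrite invf_gt1.
exists n; rewrite exprVn in hn.
by rewrite -ltf_pV2 ?posrE ?exprn_gt0.
Qed.

(** * Evaluation of power series *)

(** The same [xget 0] as in [series2_eval], so that values of formal group laws unfold to a [limit];
    a divergent sequence gets the junk value 0. *)
Definition limit (R : realType) (C : fieldType) (abs : C -> R) (u : nat -> C) : C :=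
  xget 0 [set l | abs_cvg abs u l].

Definition sev (R : realType) (C : fieldType) (abs : C -> R) (a : nat -> C) (x : C) : C :=
  limit abs (fun N => \sum_(i < N) a i * x ^+ i).

Definition ev_trunc (C : fieldType) (s : series3 C) (x y z : C) (N : nat) : C :=
  \sum_(a < N) \sum_(b < N) \sum_(c < N) s a b c * x ^+ a * y ^+ b * z ^+ c.

Definition ev3 (R : realType) (C : fieldType) (abs : C -> R) (s : series3 C)
    (x y z : C) : C := limit abs (ev_trunc s x y z).

Definition coef3 (C : fieldType) (p : {poly {poly {poly C}}}) : series3 C :=
  fun a b c => p`_a`_b`_c.

(** Truncations live in iterated polynomials, where evaluation is a ring morphism; identities
    between series are checked there and passed to the limit. *)
Definition trunc3 (C : fieldType) (s : series3 C) (N : nat) : {poly {poly {poly C}}} :=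
  \poly_(a < N) \poly_(b < N) \poly_(c < N) s a b c.

Definition horner3 (C : fieldType) (x y z : C) (p : {poly {poly {poly C}}}) : C :=
  p.[x%:P%:P].[y%:P].[z].

Section Limits.
Variables (R : realType) (C : fieldType) (abs : C -> R).
Implicit Types (x y z : C) (s t : series3 C).
Implicit Types (p q : {poly {poly {poly C}}}).
Hypothesis Habs : is_nonarch_abs abs.

Lemma abs_eq0_of_lt x : (forall e, 0 < e -> abs x < e) -> x = 0.
Proof.
move=> h; apply/eqP; rewrite -(abs_eq0b Habs) eq_le (abs_ge0 Habs) andbT.
by case: leP => // /h; rewrite ltxx.
Qed.

Lemma abs_eq0_of_geom r x : 0 <= r -> r < 1 -> (forall N, abs x <= r ^+ N) -> x = 0.
Proof.
move=> r0 r1 h; apply: abs_eq0_of_lt => e e0.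
by have [n hn] := exp_small r0 r1 e0; apply: le_lt_trans (h n) hn.
Qed.

Lemma abs_cvg_unique u l l' : abs_cvg abs u l -> abs_cvg abs u l' -> l = l'.
Proof.
move=> h h'; apply/eqP; rewrite -subr_eq0; apply/eqP; apply: abs_eq0_of_lt => e e0.
have [N hN] := h _ e0; have [N' hN'] := h' _ e0.
rewrite -(subrKA (u (maxn N N'))); apply: absD_lt => //.
  by rewrite (absB Habs); apply/hN/leq_maxl.
by apply/hN'/leq_maxr.
Qed.

Lemma limitE u l : abs_cvg abs u l -> limit abs u = l.
Proof.
move=> h; rewrite /limit; case: xgetP => [y _ hy|/(_ l)]//.
exact: abs_cvg_unique hy h.
Qed.

Lemma geom_cvg r u l : 0 <= r -> r < 1 -> (forall N, abs (l - u N) <= r ^+ N) ->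
  abs_cvg abs u l.
Proof.
move=> r0 r1 h e e0; have [n hn] := exp_small r0 r1 e0.
exists n => m nm; rewrite (absB Habs); apply: le_lt_trans (h m) _.
by apply: le_lt_trans hn; apply: ler_wiXn2l => //; apply: ltW.
Qed.

Hypothesis Hcomp : abs_complete abs.

(** By the ultrametric inequality the tail after N is bounded by its first step, without any
    geometric-series constant. Later approximations all take this shape. *)
Lemma limit_geom r u : 0 <= r -> r < 1 ->
  (forall N, abs (u N.+1 - u N) <= r ^+ N) ->
  forall N, abs (limit abs u - u N) <= r ^+ N.
Proof.
move=> r0 r1 h.
have step N k : abs (u (N + k)%N - u N) <= r ^+ N.
  elim: k => [|k ih]; first by rewrite addn0 subrr absE0// exprn_ge0.
  apply: (abs_dist_le Habs) ih; rewrite addnS; apply: le_trans (h _) _.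
  by apply: ler_wiXn2l; rewrite ?leq_addr// ltW.
have cau : abs_cauchy abs u.
  move=> e e0; have [n hn] := exp_small r0 r1 e0.
  exists n => i j ni nj; apply: le_lt_trans hn.
  apply: (abs_dist_le Habs (y := u n)).
    by rewrite -(subnKC ni).
  by rewrite (absB Habs) -(subnKC nj).
have [l hl] := Hcomp cau.
rewrite (limitE hl) => N.
case: leP => // lt; have [M hM] := hl _ (le_lt_trans (exprn_ge0 N r0) lt).
have := hM (N + M)%N (leq_addl _ _).
rewrite (absB Habs) => /(absD_lt Habs) /(_ (le_lt_trans (step N M) lt)).
by rewrite subrKA ltxx.
Qed.

Definition integral1 (a : nat -> C) := forall i, abs (a i) <= 1.
Definition integral2 (F : series2 C) := forall i j, abs (F i j) <= 1.
Definition integral3 (s : series3 C) := forall i j k, abs (s i j k) <= 1.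

Lemma sev_approx r (a : nat -> C) x : integral1 a -> abs x <= r -> r < 1 ->
  forall N, abs (sev abs a x - \sum_(i < N) a i * x ^+ i) <= r ^+ N.
Proof.
move=> ha xr r1; apply: limit_geom => [||N]//.
  exact: le_trans (abs_ge0 Habs _) xr.
rewrite big_ord_recr/= [X in X - _]addrC addrK; apply: absM_le => //.
by rewrite absX//; apply: lerXn2r => //; rewrite nnegrE ?(abs_ge0 Habs)//
  (le_trans (abs_ge0 Habs _) xr).
Qed.

Lemma sev_unique r (a : nat -> C) x l : abs x <= r -> r < 1 ->
  (forall N, abs (l - \sum_(i < N) a i * x ^+ i) <= r ^+ N) -> sev abs a x = l.
Proof.
move=> xr r1 h; apply: limitE; apply: geom_cvg h => //.
exact: le_trans (abs_ge0 Habs _) xr.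
Qed.

(* Monomials x^a y^b z^c with one of a, b, c >= N are at most r^N. *)
Lemma horner3_bound r x y z N (p : {poly {poly {poly C}}}) :
  abs x <= r -> abs y <= r -> abs z <= r -> r <= 1 ->
  integral3 (coef3 p) ->
  (forall a b c, (a < N)%N -> (b < N)%N -> (c < N)%N -> coef3 p a b c = 0) ->
  abs (horner3 x y z p) <= r ^+ N.
Proof.
move=> xr yr zr r1 ip p0.
have r0 : 0 <= r by exact: le_trans (abs_ge0 Habs _) xr.
have rN : 0 <= r ^+ N by rewrite exprn_ge0.
rewrite /horner3 [p.[_]]horner_coef !horner_sum; apply: abs_sum_le => // a _.
rewrite !hornerE [_.[y%:P]]horner_coef horner_sum mulr_suml; apply: abs_sum_le => // b _.
rewrite !hornerE [_.[z]]horner_coef !mulr_suml; apply: abs_sum_le => // c _.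
have pw w n : abs w <= r -> abs (w ^+ n) <= r ^+ n.
  by move=> wr; rewrite absX//; apply: lerXn2r => //; rewrite nnegrE ?(abs_ge0 Habs).
have p1 w n : abs w <= r -> abs (w ^+ n) <= 1.
  by move=> wr; apply: absX_le1 => //; apply: le_trans r1.
have mono n : (N <= n)%N -> r ^+ n <= r ^+ N by move=> h; apply: ler_wiXn2l.
have ipc : abs (coef3 p a b c) <= 1 by exact: ip.
case: (ltnP a N) => aN; last first.
  apply: absM_le; rewrite ?absM_le1 ?p1//.
  by apply: le_trans (mono _ aN); exact: pw.
rewrite mulrAC; case: (ltnP b N) => bN; last first.
  apply: absM_le; rewrite ?absM_le1 ?p1//.
  by apply: le_trans (mono _ bN); exact: pw.
case: (ltnP c N) => cN; last first.
  rewrite -!mulrA; apply: absM_le => //; apply: absM_le_r => //.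
    by apply: le_trans (mono _ cN); exact: pw.
  by rewrite absM_le1 ?p1.
have := p0 _ _ _ aN bN cN; rewrite /coef3 => ->.
by rewrite !mul0r absE0.
Qed.

Lemma coef3M p q : coef3 (p * q) = mul3 (coef3 p) (coef3 q).
Proof.
apply/funext => a; apply/funext => b; apply/funext => c; rewrite /coef3 /mul3.
rewrite coefM !coef_sum; apply: eq_bigr => i _.
rewrite coefM coef_sum; apply: eq_bigr => j _.
by rewrite coefM.
Qed.

Lemma coef3_trunc s N a b c : (a < N)%N -> (b < N)%N -> (c < N)%N ->
  coef3 (trunc3 s N) a b c = s a b c.
Proof. by move=> ha hb hc; rewrite /coef3 /trunc3 !(coef_poly, ha, hb, hc). Qed.

Lemma integral3_trunc s N : integral3 s -> integral3 (coef3 (trunc3 s N)).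
Proof.
move=> hs a b c; rewrite /coef3 /trunc3 coef_poly.
case: ifP => _; last by rewrite !coef0 absE0.
rewrite coef_poly; case: ifP => _; last by rewrite !coef0 absE0.
by rewrite coef_poly; case: ifP => _; rewrite ?absE0.
Qed.

Lemma integral3_mul s t : integral3 s -> integral3 t -> integral3 (mul3 s t).
Proof.
by move=> hs ht a b c; do 3! (apply: abs_sum_le => // ? _); apply: absM_le1.
Qed.

Lemma horner3_trunc x y z s N : horner3 x y z (trunc3 s N) = ev_trunc s x y z N.
Proof.
rewrite /horner3 /trunc3 /ev_trunc [_.[x%:P%:P]]horner_poly !horner_sum; apply: eq_bigr => a _.
rewrite !hornerE [_.[y%:P]]horner_poly horner_sum mulr_suml; apply: eq_bigr => b _.
rewrite !hornerE horner_poly !mulr_suml; apply: eq_bigr => c _.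
by ring.
Qed.

Lemma horner3B x y z p q : horner3 x y z (p - q) = horner3 x y z p - horner3 x y z q.
Proof. by rewrite /horner3 !(hornerD, hornerN). Qed.
Lemma horner3M x y z p q : horner3 x y z (p * q) = horner3 x y z p * horner3 x y z q.
Proof. by rewrite /horner3 !hornerM. Qed.
Lemma horner3X x y z p n : horner3 x y z (p ^+ n) = horner3 x y z p ^+ n.
Proof. by rewrite /horner3 !horner_exp. Qed.
Lemma horner3C x y z k : horner3 x y z k%:P%:P%:P = k.
Proof. by rewrite /horner3 !hornerC. Qed.
Lemma horner3_sum x y z (I : Type) (s : seq I) (f : I -> {poly {poly {poly C}}}) :
  horner3 x y z (\sum_(i <- s) f i) = \sum_(i <- s) horner3 x y z (f i).
Proof. by rewrite /horner3 !horner_sum. Qed.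

(** Congruence modulo the ideal (X^N, Y^N, Z^N). *)
Definition eqmod3 (N : nat) (s t : series3 C) :=
  forall a b c, (a < N)%N -> (b < N)%N -> (c < N)%N -> s a b c = t a b c.

Lemma horner3_eqmod r x y z N p q :
  abs x <= r -> abs y <= r -> abs z <= r -> r <= 1 ->
  integral3 (coef3 p) -> integral3 (coef3 q) -> eqmod3 N (coef3 p) (coef3 q) ->
  abs (horner3 x y z p - horner3 x y z q) <= r ^+ N.
Proof.
move=> xr yr zr r1 ip iq e; rewrite -horner3B; apply: horner3_bound => //.
- by move=> a b c; rewrite /coef3 !coefB; apply: absB_le => //; [exact: ip|exact: iq].
- by move=> a b c ha hb hc; rewrite /coef3 !coefB -/(coef3 p a b c) e// subrr.
Qed.

Lemma ev3_approx r x y z s : abs x <= r -> abs y <= r -> abs z <= r -> r < 1 ->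
  integral3 s -> forall N, abs (ev3 abs s x y z - ev_trunc s x y z N) <= r ^+ N.
Proof.
move=> xr yr zr r1 hs; apply: limit_geom => // [|N].
  exact: le_trans (abs_ge0 Habs _) xr.
rewrite -!horner3_trunc; apply: horner3_eqmod; rewrite ?(ltW r1)//;
  try exact: integral3_trunc.
by move=> a b c aN bN cN; rewrite !coef3_trunc ?ltnS// ltnW.
Qed.

Lemma ev3_unique r x y z s l : abs x <= r -> r < 1 ->
  (forall N, abs (l - ev_trunc s x y z N) <= r ^+ N) -> ev3 abs s x y z = l.
Proof.
move=> xr r1 h; apply: limitE; apply: geom_cvg h => //.
exact: le_trans (abs_ge0 Habs _) xr.
Qed.

End Limits.

Definition fev (R : realType) (C : fieldType) (abs : C -> R) (F : series2 C) : C -> C -> C :=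
  series2_eval (fun x : C => x) abs F.

(** * Substitution and products of power series *)

Section Substitution.
Variables (R : realType) (C : fieldType) (abs : C -> R).
Hypothesis Habs : is_nonarch_abs abs.
Hypothesis Hcomp : abs_complete abs.
Implicit Types (x y z : C) (s t u v : series3 C) (F : series2 C).
Implicit Types (p q : {poly {poly {poly C}}}).

Definition order_ge3 s (m : nat) := forall a b c, (a + b + c < m)%N -> s a b c = 0.

Lemma order_ge3M s t m n : order_ge3 s m -> order_ge3 t n ->
  order_ge3 (mul3 s t) (m + n).
Proof.
move=> hs ht a b c h.
apply: big1 => -[i hi] _; apply: big1 => -[j hj] _; apply: big1 => -[l hl] _ /=.
have [lt|ge] := ltnP (i + j + l) m; first by rewrite hs ?mul0r.
rewrite ht ?mulr0//; lia.
Qed.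

Lemma order_ge3X u n : u 0 0 0 = 0 -> order_ge3 (exp3 u n) n.
Proof.
move=> u0; have u1 : order_ge3 u 1 by case=> [|?] [|?] [|?].
by elim: n => [|n ih] //; exact: (order_ge3M u1 ih).
Qed.

Lemma eqmod3M N s s' t t' : eqmod3 N s s' -> eqmod3 N t t' ->
  eqmod3 N (mul3 s t) (mul3 s' t').
Proof.
move=> hs ht a b c aN bN cN.
apply: eq_bigr => -[i hi] _; apply: eq_bigr => -[j hj] _; apply: eq_bigr => -[l hl] _ /=.
by congr (_ * _); [apply: hs|apply: ht]; lia.
Qed.

Lemma coef3_1 : coef3 (1 : {poly {poly {poly C}}}) = one3 C.
Proof.
apply/funext => a; apply/funext => b; apply/funext => c; rewrite /coef3 /one3.
rewrite coef1; case: (a == 0)%N; last by rewrite mulr0n coef0 coef0.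
by rewrite mulr1n coef1; case: (b == 0)%N; rewrite ?mulr1n ?mulr0n ?coef1 ?coef0.
Qed.

Lemma coef3X_trunc u n N : eqmod3 N (coef3 (trunc3 u N ^+ n)) (exp3 u n).
Proof.
elim: n => [|n ih]; first by rewrite expr0 coef3_1.
rewrite exprS coef3M /=; apply: eqmod3M => // a b c aN bN cN.
exact: coef3_trunc.
Qed.

Lemma integral3_coefM p q : integral3 abs (coef3 p) -> integral3 abs (coef3 q) ->
  integral3 abs (coef3 (p * q)).
Proof. by move=> hp hq; rewrite coef3M; exact: (integral3_mul Habs). Qed.

Lemma integral3_one : integral3 abs (one3 C).
Proof. by move=> a b c; exact: abs_nat_le1. Qed.

Lemma integral3_coefX p n : integral3 abs (coef3 p) ->
  integral3 abs (coef3 (p ^+ n)).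
Proof.
move=> hp; elim: n => [|n ih]; last by rewrite exprS; exact: integral3_coefM.
by rewrite expr0 coef3_1; exact: integral3_one.
Qed.

Lemma integral3_exp u n : integral3 abs u -> integral3 abs (exp3 u n).
Proof.
move=> hu; elim: n => [|n ih]; first exact: integral3_one.
exact: integral3_mul.
Qed.

Lemma integral3_subst F u v : integral2 abs F -> integral3 abs u -> integral3 abs v ->
  integral3 abs (subst3 F u v).
Proof.
move=> hF hu hv a b c; do 2! (apply: abs_sum_le => // ? _).
by apply: absM_le1 => //; apply: integral3_mul => //; exact: integral3_exp.
Qed.

Lemma absX_dist x y d n : abs x <= 1 -> abs y <= 1 -> abs (x - y) <= d ->
  abs (x ^+ n - y ^+ n) <= d.
Proof.
move=> x1 y1 h; have d0 := le_trans (abs_ge0 Habs _) h.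
rewrite subrXX mulrC; apply: absM_le => //; apply: abs_sum_le => // i _.
by rewrite absM_le1 ?absX_le1.
Qed.

Lemma absM_dist x y x' y' d : abs x <= 1 -> abs y' <= 1 ->
  abs (x - x') <= d -> abs (y - y') <= d -> abs (x * y - x' * y') <= d.
Proof.
move=> x1 y1 hx hy; have -> : x * y - x' * y' = x * (y - y') + y' * (x - x') by ring.
by apply: absD_le => //; apply: absM_le.
Qed.

Definition fev_trunc F x y N := \sum_(i < N) \sum_(j < N) F i j * x ^+ i * y ^+ j.

Lemma ev_trunc_inXY F x y z N : ev_trunc (inXY F) x y z N = fev_trunc F x y N.
Proof.
rewrite /ev_trunc /fev_trunc; apply: eq_bigr => a _; apply: eq_bigr => b _.
case: N a b => [[]//|N] a b.
rewrite big_ord_recl big1 ?addr0 => [|c _]; first by rewrite /inXY/= mulr1n mulr1.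
by rewrite /inXY /= ?mulr0n !mul0r.
Qed.

Lemma ev_trunc_inYZ F x y z N : ev_trunc (inYZ F) x y z N = fev_trunc F y z N.
Proof.
rewrite /ev_trunc /fev_trunc; case: N => [|N]; first by rewrite !big_ord0.
rewrite big_ord_recl/= [X in _ + X]big1 ?addr0 => [|a _].
  by apply: eq_bigr => b _; apply: eq_bigr => c _; rewrite /inYZ ?expr0 mulr1n mulr1.
by rewrite big1 => // b _; rewrite big1 => // c _; rewrite /inYZ/= mulr0n !mul0r.
Qed.

Lemma ev3_inXY F x y z : ev3 abs (inXY F) x y z = fev abs F x y.
Proof. by congr limit; apply/funext => N; rewrite ev_trunc_inXY. Qed.

Lemma ev3_inYZ F x y z : ev3 abs (inYZ F) x y z = fev abs F y z.
Proof. by congr limit; apply/funext => N; rewrite ev_trunc_inYZ. Qed.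

Lemma integral3_inXY F : integral2 abs F -> integral3 abs (inXY F).
Proof. by move=> hF a b c; rewrite /inXY; case: (c == 0)%N; rewrite ?mulr1n ?mulr0n ?absE0. Qed.

Lemma integral3_inYZ F : integral2 abs F -> integral3 abs (inYZ F).
Proof. by move=> hF a b c; rewrite /inYZ; case: (a == 0)%N; rewrite ?mulr1n ?mulr0n ?absE0. Qed.

Lemma fev_approx r F x y : integral2 abs F -> abs x <= r -> abs y <= r -> r < 1 ->
  forall N, abs (fev abs F x y - fev_trunc F x y N) <= r ^+ N.
Proof.
move=> hF xr yr r1 N; rewrite -(ev3_inXY _ _ _ 0) -(ev_trunc_inXY _ _ _ 0).
apply: ev3_approx => //; last exact: integral3_inXY.
by rewrite absE0// (le_trans (abs_ge0 Habs _) xr).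
Qed.

Lemma fev_trunc_dist F x y x' y' d N : integral2 abs F ->
  abs x <= 1 -> abs y <= 1 -> abs x' <= 1 -> abs y' <= 1 ->
  abs (x - x') <= d -> abs (y - y') <= d ->
  abs (fev_trunc F x y N - fev_trunc F x' y' N) <= d.
Proof.
move=> hF x1 y1 x'1 y'1 hx hy; have d0 := le_trans (abs_ge0 Habs _) hx.
rewrite /fev_trunc -sumrB; apply: abs_sum_le => // i _.
rewrite -sumrB; apply: abs_sum_le => // j _.
rewrite -!mulrA -mulrBr; apply: absM_le => //.
by apply: absM_dist; rewrite ?absX_le1// absX_dist.
Qed.

Lemma ev3_le r x y z s : abs x <= r -> abs y <= r -> abs z <= r -> r < 1 ->
  integral3 abs s -> s 0 0 0 = 0 -> abs (ev3 abs s x y z) <= r.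
Proof.
move=> xr yr zr r1 hs s0; have := ev3_approx Habs Hcomp xr yr zr r1 hs 1.
by rewrite expr1 /ev_trunc !big_ord1 s0 !mul0r subr0.
Qed.

(** The polynomial [p], got by substituting the truncations of u and v in that of F, is close to
    both sides: to the right one by continuity of F, to the left one because the coefficients in the
    box a, b, c < N agree. *)
Lemma ev3_subst r F u v x y z :
  abs x <= r -> abs y <= r -> abs z <= r -> r < 1 ->
  integral2 abs F -> integral3 abs u -> integral3 abs v ->
  u 0 0 0 = 0 -> v 0 0 0 = 0 ->
  ev3 abs (subst3 F u v) x y z = fev abs F (ev3 abs u x y z) (ev3 abs v x y z).
Proof.
move=> xr yr zr r1 hF hu hv u0 v0; apply: (ev3_unique Habs xr r1).
move=> N; have r0 : 0 <= r by exact: le_trans (abs_ge0 Habs _) xr.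
have ur := ev3_le xr yr zr r1 hu u0; have vr := ev3_le xr yr zr r1 hv v0.
have le1 w : abs w <= r -> abs w <= 1 by move=> h; exact: le_trans h (ltW r1).
(* For a, b, c < N the coefficient of X^a Y^b Z^c only involves [F i j] with i, j <= a + b + c <
   3N. *)
set M := (3 * N)%N.
have tr1 s : integral3 abs s -> abs (ev_trunc s x y z N) <= 1.
  move=> hs; rewrite /ev_trunc; do 3! (apply: abs_sum_le => // ? _).
  by rewrite !(absM_le1 Habs) ?(absX_le1 Habs) ?(le1 x) ?(le1 y) ?(le1 z)//; exact: hs.
apply: (abs_dist_le Habs (y := fev_trunc F (ev3 abs u x y z) (ev3 abs v x y z) M)).
  apply: le_trans (fev_approx hF ur vr r1 M) _.
  by apply: ler_wiXn2l; rewrite ?(ltW r1)// leq_pmull.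
apply: (abs_dist_le Habs (y := fev_trunc F (ev_trunc u x y z N) (ev_trunc v x y z N) M)).
  by apply: fev_trunc_dist; do ?[exact: le1|exact: tr1|exact: hF|exact: ev3_approx].
set U := trunc3 u N; set V := trunc3 v N.
pose p := \sum_(i < M) \sum_(j < M) (F i j)%:P%:P%:P * (U ^+ i * V ^+ j).
have -> : fev_trunc F (ev_trunc u x y z N) (ev_trunc v x y z N) M = horner3 x y z p.
  rewrite horner3_sum; apply: eq_bigr => i _; rewrite horner3_sum; apply: eq_bigr => j _.
  by rewrite !horner3M !horner3X horner3C !horner3_trunc mulrA.
rewrite -horner3_trunc.
have pE a b c : coef3 p a b c =
    \sum_(i < M) \sum_(j < M) F i j * coef3 (U ^+ i * V ^+ j) a b c.
  rewrite /coef3 !coef_sum; apply: eq_bigr => i _; rewrite !coef_sum.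
  by apply: eq_bigr => j _; rewrite !coefCM.
apply: horner3_eqmod => //; rewrite ?(ltW r1)//.
- move=> a b c; rewrite pE; do 2! (apply: abs_sum_le => // ? _).
  by apply: absM_le1 => //; apply: integral3_coefM; apply: integral3_coefX;
    apply: integral3_trunc.
- by apply: integral3_trunc => //; exact: integral3_subst.
move=> a b c aN bN cN; rewrite coef3_trunc// pE.
have term i j : coef3 (U ^+ i * V ^+ j) a b c = mul3 (exp3 u i) (exp3 v j) a b c.
  by rewrite coef3M; apply: eqmod3M aN bN cN; exact: coef3X_trunc.
have vanish i j : ((a + b + c) < i + j)%N -> mul3 (exp3 u i) (exp3 v j) a b c = 0.
  by apply: order_ge3M; exact: order_ge3X.
have kM : ((a + b + c).+1 <= M)%N by rewrite /M; lia.
pose T i j := F i j * mul3 (exp3 u i) (exp3 v j) a b c.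
have T0 i j : ((a + b + c) < i + j)%N -> T i j = 0.
  by move=> h; rewrite /T vanish ?mulr0.
have widen (f : nat -> C) : (forall i, ((a + b + c) < i)%N -> f i = 0) ->
    \sum_(i < M) f i = \sum_(i < (a + b + c).+1) f i.
  move=> f0; rewrite (big_ord_widen M f kM) [LHS](bigID (fun i : 'I_M => (i < (a + b + c).+1)%N)) /=.
  by rewrite [X in _ + X]big1 ?addr0 // => i; rewrite -leqNgt => /f0.
rewrite /subst3 -/(T _ _).
transitivity (\sum_(i < M) \sum_(j < (a + b + c).+1) T i j).
  apply: eq_bigr => i _; rewrite -(widen (T i)) => [|j hj]; last by apply: T0; lia.
  by apply: eq_bigr => j _; rewrite term.
apply: (widen (fun i => \sum_(j < (a + b + c).+1) T i j)) => i hi.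
by apply: big1 => j _; apply: T0; lia.
Qed.

Lemma ev3M r s t x y z :
  abs x <= r -> abs y <= r -> abs z <= r -> r < 1 ->
  integral3 abs s -> integral3 abs t ->
  ev3 abs (mul3 s t) x y z = ev3 abs s x y z * ev3 abs t x y z.
Proof.
move=> xr yr zr r1 hs ht; apply: (ev3_unique Habs xr r1).
have le1 w : abs w <= r -> abs w <= 1 by move=> h; exact: le_trans h (ltW r1).
move=> N; apply: (abs_dist_le Habs (y := ev_trunc s x y z N * ev_trunc t x y z N)).
  apply: absM_dist; try exact: ev3_approx.
    have := ev3_approx Habs Hcomp xr yr zr r1 hs 0.
    by rewrite /ev_trunc big_ord0 subr0 expr0.
  rewrite /ev_trunc; do 3! (apply: abs_sum_le => // ? _).
  by rewrite !(absM_le1 Habs) ?(absX_le1 Habs) ?(le1 x) ?(le1 y) ?(le1 z)//; exact: hs.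
rewrite -!horner3_trunc -horner3M; apply: horner3_eqmod => //; rewrite ?(ltW r1)//.
- by apply: integral3_coefM; apply: integral3_trunc.
- by apply: integral3_trunc => //; exact: integral3_mul.
move=> a b c aN bN cN; rewrite coef3_trunc// coef3M.
by apply: (eqmod3M _ _ aN bN cN) => i j k *; exact: coef3_trunc.
Qed.

Lemma ev_trunc_delta (i j k : nat) x y z N : (i < N)%N -> (j < N)%N -> (k < N)%N ->
  ev_trunc (fun a b c => [&& a == i, b == j & c == k]%:R) x y z N = x ^+ i * y ^+ j * z ^+ k.
Proof.
move=> hi hj hk; rewrite /ev_trunc.
rewrite (bigD1 (Ordinal hi))//= [X in _ + X]big1 ?addr0 => [|a ai]; last first.
  rewrite big1 => // b _; rewrite big1 => // c _.
  by rewrite -val_eqE/= in ai; rewrite (negPf ai) !mul0r.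
rewrite (bigD1 (Ordinal hj))//= [X in _ + X]big1 ?addr0 => [|b bi]; last first.
  rewrite big1 => // c _.
  by rewrite -val_eqE/= in bi; rewrite (negPf bi) andbF !mul0r.
rewrite (bigD1 (Ordinal hk))//= [X in _ + X]big1 ?addr0 => [|c ci]; last first.
  by rewrite -val_eqE/= in ci; rewrite (negPf ci) !andbF !mul0r.
by rewrite !eqxx mul1r.
Qed.

Lemma ev3_serX x y z : ev3 abs (serX C) x y z = x.
Proof.
apply: limitE => // e e0; exists 2 => n n2.
rewrite (_ : ev_trunc _ _ _ _ _ = x ^+ 1 * y ^+ 0 * z ^+ 0).
  by rewrite expr1 !expr0 !mulr1 subrr absE0.
by apply: ev_trunc_delta; apply: leq_trans n2.
Qed.

Lemma ev3_serZ x y z : ev3 abs (serZ C) x y z = z.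
Proof.
apply: limitE => // e e0; exists 2 => n n2.
rewrite (_ : ev_trunc _ _ _ _ _ = x ^+ 0 * y ^+ 0 * z ^+ 1).
  by rewrite expr1 !expr0 !mul1r subrr absE0.
by apply: ev_trunc_delta; apply: leq_trans n2.
Qed.

Lemma integral3_serX : integral3 abs (serX C).
Proof. by move=> a b c; exact: abs_nat_le1. Qed.
Lemma integral3_serZ : integral3 abs (serZ C).
Proof. by move=> a b c; exact: abs_nat_le1. Qed.

End Substitution.

(** * The group of points of a formal group *)

Definition is_subring (C : fieldType) (A : set C) :=
  [/\ A 0, A 1, forall x, A x -> A (- x), forall x y, A x -> A y -> A (x + y)
    & forall x y, A x -> A y -> A (x * y)].

Lemma subring_sum (C : fieldType) (A : set C) (I : Type) (s : seq I) (P : pred I) (f : I -> C) :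
  is_subring A -> (forall i, P i -> A (f i)) -> A (\sum_(i <- s | P i) f i).
Proof. by case=> A0 _ _ AD _ h; elim/big_rec: _ => // i x Pi; apply: AD; exact: h. Qed.

Section FormalGroupValues.
Variables (R : realType) (C : fieldType) (abs : C -> R).
Hypothesis Habs : is_nonarch_abs abs.
Hypothesis Hcomp : abs_complete abs.
Variable F : series2 C.
Hypothesis F_int : integral2 abs F.
Hypothesis F_fgl : is_formal_group_law F.

Local Notation "x <+> y" := (fev abs F x y) (at level 45, left associativity).
Local Notation "n <.> x" := (fg_mul (fun z : C => z) abs F n x) (at level 40).

Let r0 (x : C) r : abs x <= r -> 0 <= r.
Proof. exact: le_trans (abs_ge0 Habs _). Qed.

Lemma F00 : F 0 0 = 0. Proof. by rewrite (fgl_X0 F_fgl). Qed.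

Lemma fev_le r x y : abs x <= r -> abs y <= r -> r < 1 -> abs (x <+> y) <= r.
Proof.
move=> xr yr r1; have := fev_approx Habs Hcomp F_int xr yr r1 1.
by rewrite /fev_trunc !big_ord1 F00 !mul0r subr0 expr1.
Qed.

Lemma fev_lt1 x y : abs x < 1 -> abs y < 1 -> abs (x <+> y) < 1.
Proof.
move=> x1 y1; have m1 : Num.max (abs x) (abs y) < 1 by rewrite gt_max x1.
by apply: le_lt_trans (m1); apply: fev_le; rewrite // le_max lexx ?orbT.
Qed.

Lemma fevA x y z : abs x < 1 -> abs y < 1 -> abs z < 1 ->
  x <+> y <+> z = x <+> (y <+> z).
Proof.
move=> x1 y1 z1; pose r := Num.max (abs x) (Num.max (abs y) (abs z)).
have r1 : r < 1 by rewrite /r !gt_max x1 y1.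
have [xr yr zr] : [/\ abs x <= r, abs y <= r & abs z <= r].
  by rewrite /r !le_max !lexx ?orbT.
have := congr1 (fun s => ev3 abs s x y z)
  (_ : subst3 F (inXY F) (serZ C) = subst3 F (serX C) (inYZ F)).
rewrite !(ev3_subst Habs Hcomp xr yr zr r1) //;
  try by [exact: integral3_inXY|exact: integral3_inYZ|exact: integral3_serX
         |exact: integral3_serZ|rewrite /inXY F00 mul0rn|rewrite /inYZ F00 mul0rn].
rewrite ev3_inXY ev3_inYZ ev3_serX// ev3_serZ// => -> //.
by do 3! (apply/funext => ?); exact: fgl_assoc.
Qed.

Lemma fevC x y : x <+> y = y <+> x.
Proof.
congr limit; apply/funext => N; rewrite exchange_big; apply: eq_bigr => i _.
by apply: eq_bigr => j _; rewrite (fgl_comm F_fgl) mulrAC.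
Qed.

Lemma fev0 x : x <+> 0 = x.
Proof.
apply: limitE => // e e0; exists 2 => -[|[|N]]// _.
have z0X (j : 'I_N.+2) : j != ord0 -> 0 ^+ j = 0 :> C.
  by rewrite -val_eqE/= expr0n => /negPf ->.
rewrite (_ : \sum_(i < _) _ = x) ?subrr ?absE0//.
rewrite (bigD1 (inord 1))//= [X in _ + X]big1 ?addr0 => [|i i1].
  rewrite (bigD1 ord0)//= [X in _ + X]big1 ?addr0 => [|j j0].
    by rewrite inordK// (fgl_X0 F_fgl) mul1r expr1 expr0 mulr1.
  by rewrite z0X ?mulr0.
apply: big1 => j _; have [->|j0] := eqVneq j ord0.
  rewrite (fgl_X0 F_fgl) /=; move: i1; rewrite -val_eqE/= inordK// => /negPf ->.
  by rewrite !mul0r.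
by rewrite z0X ?mulr0.
Qed.

(** The bound is asked from index 2 on, because the truncations of F contain the monomials X and Y
    only from there. *)
Lemma abs_le_of_approx r (l : C) (u : nat -> C) m : 0 <= r -> r < 1 ->
  (forall N, abs (l - u N) <= r ^+ N) -> (forall N, abs (u N.+2) <= m) -> abs l <= m.
Proof.
move=> rge0 r1 h hm; case: leP => // lt.
have m0 : 0 <= m by exact: r0 (hm 0%N).
have [N hN] := exp_small rge0 r1 (le_lt_trans m0 lt).
have := absD_lt Habs (le_lt_trans (h N.+2) (le_lt_trans _ hN)) (le_lt_trans (hm N) lt).
by rewrite subrK ltxx => ->//; apply: ler_wiXn2l; rewrite ?(ltW r1)// -addn2 leq_addr.
Qed.

(* Only the terms X^i Y^j with i, j >= 1 contribute, besides X and Y. *)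
Lemma fev_dist x y y' : abs x < 1 -> abs y < 1 -> abs y' < 1 ->
  abs (x <+> y - x <+> y' - (y - y')) <= abs x * abs (y - y').
Proof.
move=> x1 y1 y'1; pose r := Num.max (abs x) (Num.max (abs y) (abs y')).
have r1 : r < 1 by rewrite /r !gt_max x1 y1.
have [xr yr zr] : [/\ abs x <= r, abs y <= r & abs y' <= r].
  by rewrite /r !le_max !lexx ?orbT.
apply: (@abs_le_of_approx r _
  (fun N => fev_trunc F x y N - fev_trunc F x y' N - (y - y'))) => // [||N].
- exact: r0 xr.
- move=> N; have -> : x <+> y - x <+> y' - (y - y') -
       (fev_trunc F x y N - fev_trunc F x y' N - (y - y')) =
     (x <+> y - fev_trunc F x y N) - (x <+> y' - fev_trunc F x y' N) by ring.
  by apply: absB_le => //; apply: fev_approx.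
have b0 : 0 <= abs x * abs (y - y') by rewrite mulr_ge0 ?(abs_ge0 Habs).
rewrite /fev_trunc -sumrB big_ord_recl /=.
have -> : \sum_(j < N.+2) F 0%N j * x ^+ 0 * y ^+ j -
          \sum_(j < N.+2) F 0%N j * x ^+ 0 * y' ^+ j = y - y'.
  by rewrite -sumrB !big_ord_recl big1 => [|j _];
    rewrite !(fgl_0Y F_fgl) /= !(mul0r, mul1r, expr0, expr1, subrr, add0r, addr0).
rewrite addrC addKr; apply: abs_sum_le => // i _.
rewrite -sumrB; apply: abs_sum_le => // j _.
rewrite /= /bump /= add1n exprS -!mulrA -!mulrBr.
apply: absM_le => //; rewrite (absM Habs) ler_wpM2l ?(abs_ge0 Habs)//.
apply: absM_le => //; first by apply: absX_le1 => //; exact: ltW.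
by apply: absX_dist => //; exact: ltW.
Qed.

(** By [fev_dist] the error is smaller than y - y' by the factor |x| < 1, so y - y' dominates:
    translations are isometries. *)
Lemma fevB x y y' : abs x < 1 -> abs y < 1 -> abs y' < 1 ->
  abs (x <+> y - x <+> y') = abs (y - y').
Proof.
move=> x1 y1 y'1; have [->|yy] := eqVneq y y'; first by rewrite !subrr.
have h := fev_dist x1 y1 y'1.
have : abs (x <+> y - x <+> y' - (y - y')) < abs (y - y').
  by apply: le_lt_trans h _; rewrite gtr_pMl// abs_gt0// subr_eq0.
by rewrite absB// => /(abs_close_eq Habs).
Qed.

Lemma fev_inj x y y' : abs x < 1 -> abs y < 1 -> abs y' < 1 ->
  x <+> y = x <+> y' -> y = y'.
Proof.
move=> x1 y1 y'1 e; apply/eqP; rewrite -subr_eq0 -(abs_eq0b Habs) -(fevB x1)//.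
by rewrite e subrr absE0.
Qed.

Lemma fev_approx_add x y : abs x < 1 -> abs y < 1 ->
  abs (x <+> y - x - y) <= abs x * abs y.
Proof.
move=> x1 y1; have := fev_dist x1 y1 (_ : abs 0 < 1).
by rewrite fev0 !subr0; apply; rewrite absE0.
Qed.

Lemma fg_mulS n x : n.+1 <.> x = x <+> (n <.> x). Proof. by []. Qed.

Lemma fg_mul_le n x : abs x < 1 -> abs (n <.> x) <= abs x.
Proof.
move=> x1; elim: n => [|n ih]; first by rewrite /fg_mul/= absE0// (abs_ge0 Habs).
by rewrite fg_mulS; apply: fev_le.
Qed.

Lemma fg_mul_lt1 n x : abs x < 1 -> abs (n <.> x) < 1.
Proof. by move=> x1; exact: le_lt_trans (fg_mul_le n x1) x1. Qed.

Lemma fg_mulD m n x : abs x < 1 -> (m + n) <.> x = (m <.> x) <+> (n <.> x).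
Proof.
move=> x1; elim: m => [|m ih]; first by rewrite add0n [0 <.> x]/fg_mul/= fevC fev0.
by rewrite addSn !fg_mulS ih fevA//; exact: fg_mul_lt1.
Qed.

Lemma fg_mulM m n x : abs x < 1 -> (m * n) <.> x = m <.> (n <.> x).
Proof.
by move=> x1; elim: m => [|m ih]//; rewrite mulSn fg_mulD// ih fg_mulS.
Qed.

Lemma fg_mul_fev n x y : abs x < 1 -> abs y < 1 ->
  n <.> (x <+> y) = (n <.> x) <+> (n <.> y).
Proof.
move=> x1 y1; elim: n => [|n ih]; first by rewrite /fg_mul/= fev0.
have xn := fg_mul_lt1 n x1; have yn := fg_mul_lt1 n y1.
rewrite !fg_mulS ih (fevA x1 y1 (fev_lt1 xn yn)) (fevA x1 xn (fev_lt1 y1 yn)).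
by rewrite -(fevA y1 xn yn) (fevC y) (fevA xn y1 yn).
Qed.

Lemma fg_mul0 n : n <.> 0 = 0.
Proof. by elim: n => [|n ih]//; rewrite fg_mulS ih fev0. Qed.

Lemma fg_mul_approx n x : abs x < 1 -> abs (n <.> x - n%:R * x) <= abs x ^+ 2.
Proof.
move=> x1; elim: n => [|n ih].
  by rewrite mul0r subr0 absE0// exprn_ge0 ?(abs_ge0 Habs).
rewrite fg_mulS -natr1 mulrDl mul1r.
have -> : x <+> (n <.> x) - (n%:R * x + x) =
  (x <+> (n <.> x) - x - (n <.> x)) + (n <.> x - n%:R * x) by ring.
apply: absD_le => //; apply: le_trans (fev_approx_add x1 (fg_mul_lt1 n x1)) _.
by rewrite expr2 ler_wpM2l ?(abs_ge0 Habs)// fg_mul_le.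
Qed.

(** The multiplication series [n](X), kept in three variables so that [subst3] applies; only X
    occurs in it. *)
Definition mul_series (n : nat) : series3 C := iter n (subst3 F (serX C)) (fun _ _ _ => 0).

Definition mul_coef (n a : nat) : C := mul_series n a 0%N 0%N.

Lemma integral3_mul_series n : integral3 abs (mul_series n).
Proof.
elim: n => [|n ih]; first by move=> *; rewrite absE0.
by apply: integral3_subst => //; exact: integral3_serX.
Qed.

Lemma mul_series0 n : mul_series n 0 0 0 = 0.
Proof.
case: n => [|n]//=; rewrite /subst3 big1 => // -[i hi] _; apply: big1 => -[j hj] _ /=.
by case: i hi => [|i]//; case: j hj => [|j]//; rewrite F00 mul0r.
Qed.

Lemma mul_coef0 n : mul_coef n 0 = 0. Proof. exact: mul_series0. Qed.

Lemma mul3_1l (s : series3 C) : mul3 (one3 C) s = s.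
Proof.
apply/funext => a; apply/funext => b; apply/funext => c.
pose N := (a + b + c).+1; have [aN bN cN] : [/\ a < N, b < N & c < N]%N by split; lia.
rewrite -(@coef3_trunc _ s N)// -[in RHS](mul1r (trunc3 s N)) coef3M coef3_1.
by apply: (@eqmod3M _ N) => // i j k iN jN kN; rewrite coef3_trunc.
Qed.

Lemma mul3_1r (s : series3 C) : mul3 s (one3 C) = s.
Proof.
apply/funext => a; apply/funext => b; apply/funext => c.
pose N := (a + b + c).+1; have [aN bN cN] : [/\ a < N, b < N & c < N]%N by split; lia.
rewrite -(@coef3_trunc _ s N)// -[in RHS](mulr1 (trunc3 s N)) coef3M coef3_1.
by apply: (@eqmod3M _ N) => // i j k iN jN kN; rewrite coef3_trunc.
Qed.

Lemma mul_coef1 n : mul_coef n 1 = n%:R.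
Proof.
elim: n => [|n ih]//; rewrite -natr1 -ih /mul_coef /=.
set u := mul_series n; have u0 : u 0 0 0 = 0 := mul_series0 n.
rewrite /subst3 !big_ord_recl !big_ord0 /= /bump /= !addn0.
rewrite F00 (fgl_0Y F_fgl) (fgl_X0 F_fgl) /= !mul3_1l !mul3_1r.
rewrite (order_ge3M (m := 1) (n := 1)) => [|i k l|i k l|]//.
- by rewrite /serX/=; ring.
- by case: i k l => [|?] [|?] [|?].
- by case: i k l => [|?] [|?] [|?].
Qed.

Lemma ev3_sev (s : series3 C) x : ev3 abs s x 0 0 = sev abs (fun a => s a 0%N 0%N) x.
Proof.
congr limit; apply/funext => N; rewrite /ev_trunc.
case: N => [|N]; first by rewrite !big_ord0.
apply: eq_bigr => a _; rewrite big_ord_recl/= big_ord_recl/= !expr0 !mulr1.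
rewrite big1 => [|c _]; last by rewrite expr0n/= mulr0.
rewrite big1 ?addr0// => b _; apply: big1 => c _.
by rewrite [X in _ * X * _]expr0n/= mulr0 mul0r.
Qed.

Lemma fg_mul_ev3 n x : abs x < 1 -> n <.> x = ev3 abs (mul_series n) x 0 0.
Proof.
move=> x1; elim: n => [|n ih].
  apply/esym/(limitE Habs) => e e0; exists 0%N => N _.
  rewrite /ev_trunc big1 ?subrr ?absE0// => a _; rewrite big1// => b _.
  by rewrite big1// => c _; rewrite !mul0r.
have z0 : abs 0 <= abs x by rewrite absE0// (abs_ge0 Habs).
rewrite fg_mulS ih [mul_series _]/= (ev3_subst Habs Hcomp (lexx (abs x)) z0 z0)//.
- by rewrite ev3_serX.
- exact: integral3_serX.
- exact: integral3_mul_series.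
- exact: mul_series0.
Qed.

Lemma fg_mul_sev n x : abs x < 1 -> n <.> x = sev abs (mul_coef n) x.
Proof. by move=> x1; rewrite fg_mul_ev3// ev3_sev. Qed.

Lemma integral1_mul_coef n : integral1 abs (mul_coef n).
Proof. by move=> a; exact: integral3_mul_series. Qed.

Lemma mul_coef_in (A : set C) n a : is_subring A -> (forall i j, A (F i j)) ->
  A (mul_coef n a).
Proof.
move=> hA hF; case: (hA) => A0 A1 _ _ AM.
pose S (s : series3 C) := forall i j k, A (s i j k).
have Snat (f : nat -> nat -> nat -> bool) : S (fun i j k => (f i j k)%:R).
  by move=> i j k; case: (f i j k).
have SM s t : S s -> S t -> S (mul3 s t).
  by move=> hs ht i j k; do 3! (apply: subring_sum => // ? _); exact: AM.
have SX s m : S s -> S (exp3 s m).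
  by move=> hs; elim: m => [|m ih]; [exact: Snat|exact: SM].
suff : S (mul_series n) by move=> h; exact: h.
elim: n => [|n ih]; first by move=> i j k.
move=> i j k; rewrite /mul_series/= /subst3; do 2! (apply: subring_sum => // ? _).
by apply: AM => //; apply: SM; apply: SX => //; exact: Snat.
Qed.

(** F(Y, u) becomes a series in the single variable Y, with the values of the rows of F at u as
    coefficients; its zeros can then be studied by Weierstrass preparation. *)
Lemma fev_sev x y : abs x < 1 -> abs y < 1 ->
  x <+> y = sev abs (fun i => sev abs (F i) y) x.
Proof.
move=> x1 y1; pose r := Num.max (abs x) (abs y).
have r1 : r < 1 by rewrite /r gt_max x1.
have [xr yr] : abs x <= r /\ abs y <= r by rewrite /r !le_max !lexx orbT.
apply/esym/(sev_unique Habs xr r1) => N.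
apply: (abs_dist_le Habs (y := fev_trunc F x y N)); first exact: fev_approx.
rewrite /fev_trunc -sumrB; apply: abs_sum_le; rewrite ?exprn_ge0 ?(r0 xr)// => i _.
have -> : \sum_(j < N) F i j * x ^+ i * y ^+ j = (\sum_(j < N) F i j * y ^+ j) * x ^+ i.
  by rewrite mulr_suml; apply: eq_bigr => j _; rewrite mulrAC.
rewrite -mulrBl mulrC absM_le ?absX_le1 ?(ltW x1)// absB//.
exact: sev_approx.
Qed.

End FormalGroupValues.

(** * Weierstrass preparation *)

Section SeriesProduct.
Variables (R : realType) (C : fieldType) (abs : C -> R).
Hypothesis Habs : is_nonarch_abs abs.
Hypothesis Hcomp : abs_complete abs.

Definition conv (a b : nat -> C) (n : nat) := \sum_(i < n.+1) a i * b (n - i)%N.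

Lemma sev_conv a b x : integral1 abs a -> integral1 abs b -> abs x < 1 ->
  sev abs (conv a b) x = sev abs a x * sev abs b x.
Proof.
move=> ha hb x1; pose s (f : nat -> C) : series3 C := fun i _ _ => f i.
pose t (f : nat -> C) : series3 C := fun i j k => f i *+ ((j == 0) && (k == 0))%N.
have ti f : integral1 abs f -> integral3 abs (t f).
  by move=> hf i j k; rewrite /t; case: (_ && _); rewrite ?mulr1n ?mulr0n ?absE0.
have te f : sev abs f x = ev3 abs (t f) x 0 0.
  by rewrite ev3_sev; congr sev; apply/funext => i; rewrite /t mulr1n.
have z0 : abs 0 <= abs x by rewrite absE0// (abs_ge0 Habs).
rewrite (te a) (te b) -(ev3M Habs Hcomp (lexx _) z0 z0)//; try exact: ti.
rewrite ev3_sev; congr sev; apply/funext => n; apply: eq_bigr => i _.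
by rewrite !big_ord1 /t !mulr1n.
Qed.

Lemma sev_poly (P : {poly C}) x : sev abs (fun i => P`_i) x = P.[x].
Proof.
apply: limitE => // e e0; exists (size P) => N hN.
rewrite horner_coef (big_ord_widen _ (fun i => P`_i * x ^+ i) hN) [X in abs (X - _)](bigID (fun i : 'I_N => (i < size P)%N)) /=.
rewrite [X in _ + X - _]big1 ?addr0 ?subrr ?absE0// => i.
by rewrite -leqNgt => h; rewrite nth_default ?mul0r.
Qed.

End SeriesProduct.

Section Weierstrass.
Variables (R : realType) (C : fieldType) (abs : C -> R).
Hypothesis Habs : is_nonarch_abs abs.
Hypothesis Hcomp : abs_complete abs.
Variable A : set C.
Hypothesis A_subring : is_subring A.
Hypothesis A_inv : forall x, A x -> abs x = 1 -> A x^-1.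
Hypothesis A_lim : forall u l, (forall n, A (u n)) -> abs_cvg abs u l -> A l.

Section Division.
Variable U : nat -> C.
Hypothesis U_int : integral1 abs U.
Hypothesis U0 : abs (U 0%N) = 1.
Hypothesis UA : forall n, A (U n).
Implicit Types b : nat -> C.

Fixpoint div_seq b (n : nat) : seq C :=
  if n is m.+1 then
    let s := div_seq b m in
    rcons s ((b m - \sum_(i < m) s`_i * U (m - i)%N) / U 0%N)
  else [::].

(* The quotient b / U of power series. *)
Definition sdiv b (m : nat) : C := (div_seq b m.+1)`_m.

Lemma size_div_seq b n : size (div_seq b n) = n.
Proof. by elim: n => //= n ih; rewrite size_rcons ih. Qed.

Lemma nth_div_seq b n i : (i < n)%N -> (div_seq b n)`_i = sdiv b i.
Proof.
elim: n => // n ih; rewrite ltnS leq_eqVlt => /orP[/eqP->//|lt].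
by rewrite /= nth_rcons size_div_seq lt ih.
Qed.

Lemma sdiv_rec b m :
  sdiv b m = (b m - \sum_(i < m) sdiv b i * U (m - i)%N) / U 0%N.
Proof.
rewrite {1}/sdiv /= nth_rcons size_div_seq ltnn eqxx; congr ((_ - _) / _).
by apply: eq_bigr => i _; rewrite nth_div_seq.
Qed.

Lemma sdiv_mul b m : \sum_(i < m.+1) sdiv b i * U (m - i)%N = b m.
Proof.
have U00 : U 0%N != 0 by rewrite -(abs_gt0 Habs) U0 ltr01.
by rewrite big_ord_recr/= subnn sdiv_rec divfK// addrC subrK.
Qed.

Lemma sdiv_dist b b' d : (forall m, abs (b m - b' m) <= d) ->
  forall m, abs (sdiv b m - sdiv b' m) <= d.
Proof.
move=> h; elim/ltn_ind => m ih; rewrite !sdiv_rec -mulrBl.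
rewrite (absM Habs) absV// U0 invr1 mulr1.
have -> : b m - \sum_(i < m) sdiv b i * U (m - i)%N -
    (b' m - \sum_(i < m) sdiv b' i * U (m - i)%N) =
    (b m - b' m) - \sum_(i < m) (sdiv b i - sdiv b' i) * U (m - i)%N.
  rewrite [in RHS](eq_bigr _ (fun i _ => mulrBl _ _ _)) sumrB; ring.
apply: absB_le => //; apply: abs_sum_le => // [|i _].
  exact: le_trans (abs_ge0 Habs _) (h m).
by apply: absM_le_r => //; exact: ih.
Qed.

Lemma sdiv_in b : (forall m, A (b m)) -> forall m, A (sdiv b m).
Proof.
case: (A_subring) => _ _ AN AD AM h; elim/ltn_ind => m ih; rewrite sdiv_rec.
apply: (AM _ _ _ (A_inv (UA 0%N) U0)); apply: (AD _ _ (h m)); apply: AN.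
by apply: subring_sum => // i _; apply: AM => //; exact: ih.
Qed.

Lemma sdiv0 m : sdiv (fun=> 0) m = 0.
Proof.
elim/ltn_ind: m => m ih; rewrite sdiv_rec big1 ?subr0 ?mul0r// => i _.
by rewrite ih ?mul0r.
Qed.

End Division.

Variables (f : nat -> C) (d : nat) (w : R).
Hypothesis fA : forall n, A (f n).
Hypothesis f_int : integral1 abs f.
Hypothesis fd : abs (f d) = 1.
Hypothesis w1 : w < 1.
Hypothesis w0 : 0 <= w.
Hypothesis f_low : forall j, (j < d)%N -> abs (f j) <= w.

Let U n := f (n + d)%N.

(* Solving (q * f)_(m + d) = [m = 0] for q: the coefficients of f of index
   at least d form an invertible series, the others are small. *)
Definition wstep (q : nat -> C) (m : nat) : C :=
  (m == 0%N)%:R - \sum_(i < d) q (m.+1 + i)%N * f (d - i.+1)%N.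

Definition witer (k : nat) : nat -> C := iter k (fun q => sdiv U (wstep q)) (fun=> 0).

Let U_int : integral1 abs U. Proof. by move=> n; exact: f_int. Qed.
Let U0 : abs (U 0%N) = 1. Proof. exact: fd. Qed.
Let UA n : A (U n). Proof. exact: fA. Qed.

(** Only the small coefficients of index below d enter, so the iteration is a contraction of ratio
    w. *)
Lemma wstep_dist q q' e : (forall m, abs (q m - q' m) <= e) ->
  forall m, abs (wstep q m - wstep q' m) <= w * e.
Proof.
move=> h m; have e0 : 0 <= e by exact: le_trans (abs_ge0 Habs _) (h m).
rewrite /wstep opprD opprK addrACA subrr add0r addrC -sumrB.
apply: abs_sum_le; rewrite ?mulr_ge0// => i _.
rewrite -mulrBl (absM Habs) mulrC ler_pM ?(abs_ge0 Habs)//; last by rewrite absB.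
by apply: f_low; rewrite ltn_subrL (leq_ltn_trans _ (ltn_ord i)).
Qed.

Lemma wstep_in q : (forall m, A (q m)) -> forall m, A (wstep q m).
Proof.
case: (A_subring) => A0 A1 AN AD AM h m; apply: AD; first by case: (m == 0%N).
by apply: AN; apply: subring_sum => // i _; exact: AM.
Qed.

Lemma witer_in k m : A (witer k m).
Proof.
elim: k m => [|k ih] m; first by case: A_subring.
by apply: sdiv_in => // n; exact: wstep_in.
Qed.

Lemma witer_dist k m : abs (witer k.+1 m - witer k m) <= w ^+ k.
Proof.
elim: k m => [|k ih] m; last by rewrite exprS; apply: sdiv_dist => // n; apply: wstep_dist.
have -> : witer 1 m - witer 0 m = sdiv U (wstep (fun=> 0)) m - sdiv U (fun=> 0) m.
  by rewrite sdiv0.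
rewrite expr0; apply: sdiv_dist => // n.
rewrite subr0 /wstep big1 ?subr0 => [|i _] /=; last by rewrite mul0r.
exact: abs_nat_le1.
Qed.

Definition wquot (m : nat) : C := limit abs (fun k => witer k m).

Lemma wquot_approx k m : abs (wquot m - witer k m) <= w ^+ k.
Proof.
by apply: (@limit_geom _ _ _ Habs Hcomp w (fun k => witer k m)) => // N; exact: witer_dist.
Qed.

Lemma wquot_in m : A (wquot m).
Proof.
apply: (@A_lim (fun k => witer k m)) => [k|]; first exact: witer_in.
by apply: (geom_cvg Habs w0 w1) => k; exact: wquot_approx.
Qed.

Lemma wquot_int : integral1 abs wquot.
Proof. by move=> m; have := wquot_approx 0 m; rewrite /= subr0 expr0. Qed.

Lemma wquot_eq m : \sum_(i < m.+1) wquot i * U (m - i)%N = wstep wquot m.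
Proof.
apply/eqP; rewrite -subr_eq0; apply/eqP.
apply: (abs_eq0_of_geom Habs w0 w1) => k.
apply: (abs_dist_le Habs (y := wstep (witer k) m)); last first.
  apply: le_trans (wstep_dist (e := w ^+ k) _ m) _ => [n|].
    by rewrite absB//; exact: wquot_approx.
  by rewrite ler_piMl ?exprn_ge0// ltW.
rewrite -[X in abs (_ - X)](sdiv_mul U0 (wstep (witer k))) -sumrB.
apply: abs_sum_le; rewrite ?exprn_ge0// => i _.
rewrite -mulrBl; apply: absM_le_r => //; apply: le_trans (wquot_approx k.+1 i) _.
by rewrite exprS ler_piMl ?exprn_ge0// ltW.
Qed.

(** The product of [wquot] and f has coefficient 1 in degree d and 0 beyond, so it is a monic
    polynomial. Since [wquot] has a constant term of absolute value 1, it has no zero in the open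
    disc, and P and f have the same zeros there. *)
Lemma weierstrass_preparation : exists P : {poly C},
  [/\ P \is monic, size P = d.+1, (forall i, A P`_i /\ abs P`_i <= 1),
     (forall x, root P x -> abs x < 1)
   & forall x, abs x < 1 -> root P x <-> sev abs f x = 0].
Proof.
have conv_hi m : conv wquot f (m + d) = (m == 0%N)%:R.
  have e : conv wquot f (m + d) = \sum_(i < m.+1) wquot i * U (m - i)%N +
      \sum_(i < d) wquot (m.+1 + i)%N * f (d - i.+1)%N.
    rewrite /conv -addSn big_split_ord /=; congr (_ + _); apply: eq_bigr => -[i hi] _ /=;
      congr (_ * f _); lia.
  by rewrite e wquot_eq /wstep subrK.
have conv_lo n : (n < d)%N -> abs (conv wquot f n) <= w.
  move=> nd; apply: abs_sum_le => // -[i hi] _ /=; apply: absM_le => //.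
    exact: wquot_int.
  by apply: f_low; lia.
have conv_d : conv wquot f d = 1 by have := conv_hi 0; rewrite add0n.
have q0 : abs (wquot 0) = 1.
  have := wquot_eq 0; rewrite big_ord1 /wstep /= => /(congr1 abs).
  rewrite (absM Habs) U0 mulr1 absD_dom ?abs1// absN//; apply: le_lt_trans w1.
  apply: abs_sum_le => // i _; apply: absM_le; rewrite ?wquot_int//.
  by apply: f_low; rewrite ltn_subrL (leq_ltn_trans _ (ltn_ord i)).
have cA n : A (conv wquot f n).
  apply: subring_sum => // i _; case: (A_subring) => _ _ _ _; apply => //.
  exact: wquot_in.
have ci : integral1 abs (conv wquot f).
  by move=> n; apply: abs_sum_le => // i _; apply: absM_le1 => //; exact: wquot_int.
pose P := \poly_(n < d.+1) conv wquot f n.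
have PE n : P`_n = conv wquot f n.
  rewrite coef_poly ltnS; case: leqP => // dn.
  by rewrite -(subnK (ltnW dn)) conv_hi subn_eq0 leqNgt dn.
have sP : size P = d.+1 by rewrite size_poly_eq// conv_d oner_neq0.
have mP : P \is monic by rewrite monicE lead_coefE sP PE conv_d.
exists P; split=> //.
- by move=> i; rewrite PE.
(* The coefficients below d are at most w < 1, so x^d would dominate if |x| >= 1. *)
- move=> x; rewrite /root horner_coef sP big_ord_recr/= PE conv_d mul1r => /eqP e.
  case: (ltP (abs x) 1) => // x1.
  have := absD_dom Habs (_ : abs (\sum_(i < d) P`_i * x ^+ i) < abs (x ^+ d)).
  rewrite addrC e absE0// absX// => h.
  have xd : 1 <= abs x ^+ d by rewrite exprn_ege1.
  have : 0 = abs x ^+ d.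
    apply: h; apply: (@le_lt_trans _ _ (w * abs x ^+ d)).
      apply: abs_sum_le => // [|i _].
        by rewrite mulr_ge0// exprn_ge0// (abs_ge0 Habs).
      rewrite (absM Habs) ler_pM ?(abs_ge0 Habs)//.
        by rewrite PE; exact: conv_lo.
      by rewrite absX// ler_weXn2l// ltnW.
    by rewrite gtr_pMl// (lt_le_trans ltr01).
  by move=> e0; rewrite -e0 ler10 in xd.
move=> x x1; rewrite /root -(sev_poly Habs).
have -> : sev abs (fun i => P`_i) x = sev abs wquot x * sev abs f x.
  rewrite -(sev_conv Habs Hcomp wquot_int f_int x1); congr sev.
  by apply/funext => n; rewrite PE.
suff q1 : sev abs wquot x != 0 by rewrite mulf_eq0 (negPf q1); split => /eqP.
rewrite -(abs_gt0 Habs).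
have := sev_approx Habs Hcomp wquot_int (lexx (abs x)) x1 1.
rewrite big_ord1 expr0 mulr1 expr1 => h.
have : abs (sev abs wquot x - wquot 0) < abs (wquot 0) by rewrite q0; exact: le_lt_trans h x1.
by rewrite absB// => /(abs_close_eq Habs) ->; rewrite q0 ltr01.
Qed.

End Weierstrass.

(** * Splitting of integral polynomials in the completion *)

Section AlgebraicallyClosed.
Variables (R : realType) (C : fieldType) (abs : C -> R).
Hypothesis Habs : is_nonarch_abs abs.
Hypothesis Hcomp : abs_complete abs.

Implicit Types (P Q : {poly C}).

Definition integral_poly P := forall i, abs P`_i <= 1.

Lemma root_integral_le1 P x : P \is monic -> integral_poly P -> root P x -> abs x <= 1.
Proof.
move=> mP iP; rewrite /root horner_coef => /eqP e; case: leP => // x1.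
have sP : (0 < size P)%N by rewrite size_poly_gt0 monic_neq0.
move: e; rewrite -(prednK sP) big_ord_recr/= -lead_coefE (monicP mP) mul1r => e.
have x0 : 0 < abs x by exact: lt_trans ltr01 x1.
have := absD_dom Habs (_ : abs (\sum_(i < (size P).-1) P`_i * x ^+ i) < abs (x ^+ (size P).-1)).
rewrite addrC e absE0// absX// => h.
suff /h : abs (\sum_(i < (size P).-1) P`_i * x ^+ i) < abs x ^+ (size P).-1.
  by move/eqP; rewrite eq_sym expf_eq0 gt_eqF ?andbF.
case: (size P).-1 => [|n]; first by rewrite big_ord0 absE0// expr0 ltr01.
apply: (@le_lt_trans _ _ (abs x ^+ n)); last by rewrite exprS ltr_pMl ?exprn_gt0.
apply: abs_sum_le => // [|i _]; first by rewrite exprn_ge0 ?ltW.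
by apply: absM_le => //; rewrite absX// ler_weXn2l ?(ltW x1)// -ltnS.
Qed.

Lemma horner_dist P x y : integral_poly P -> abs x <= 1 -> abs y <= 1 ->
  abs (P.[x] - P.[y]) <= abs (x - y).
Proof.
move=> iP x1 y1; rewrite !horner_coef -sumrB.
apply: abs_sum_le => // [|i _]; first exact: abs_ge0.
by rewrite -mulrBr; apply: absM_le => //; apply: absX_dist.
Qed.

Lemma horner_coef_dist P Q x e : (forall i, abs (P`_i - Q`_i) <= e) -> abs x <= 1 ->
  abs (P.[x] - Q.[x]) <= e.
Proof.
move=> h x1; have e0 : 0 <= e by exact: le_trans (abs_ge0 Habs _) (h 0%N).
rewrite -hornerN -hornerD horner_coef; apply: abs_sum_le => // i _.
by rewrite coefB; apply: absM_le_r => //; exact: absX_le1.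
Qed.

Variables (Kbar : closedFieldType) (h : {rmorphism Kbar -> C}).
Hypothesis h_dense : forall (z : C) (e : R), 0 < e -> exists x : Kbar, abs (z - h x) < e.

Lemma monic_approx P e : P \is monic -> 0 < e ->
  exists Q : {poly Kbar}, [/\ Q \is monic, size Q = size P &
    forall i, abs (P`_i - h Q`_i) <= e].
Proof.
move=> mP e0; have [g hg] := choice (fun i => h_dense P`_i e0).
have sP : (0 < size P)%N by rewrite size_poly_gt0 monic_neq0.
pose d := (size P).-1.
have sd : size P = d.+1 by rewrite prednK.
pose q := \poly_(i < d) g i.
have sq : (size q < size ('X^d : {poly Kbar}))%N by rewrite size_polyXn ltnS size_poly.
exists ('X^d + q); split.
- by rewrite monicE lead_coefDl// lead_coefXn.
- by rewrite size_polyDl// size_polyXn.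
move=> i; rewrite coefD coefXn coef_poly; case: (ltngtP i d) => [id|id|->].
- by rewrite add0r ltW.
- by rewrite addr0 rmorph0 subr0 nth_default ?absE0 ?ltW// sd.
- by rewrite addr0 rmorph1 /d -lead_coefE (monicP mP) subrr absE0 ?ltW.
Qed.

(** P is approximated by polynomials over Kbar, which split. A root of one approximation nearly
    annihilates the next, hence is close to one of its roots; this yields a Cauchy sequence of
    roots. *)
Lemma integral_poly_root P : P \is monic -> integral_poly P -> (1 < size P)%N ->
  exists x, root P x.
Proof.
move=> mP iP sP; pose d := (size P).-1; pose t : R := 2^-1.
have t0 : 0 < t by rewrite invr_gt0 ltr0n.
have t1 : t < 1 by rewrite invf_lt1 ?ltr1n ?ltr0n.
have tk k : 0 < t ^+ k by rewrite exprn_gt0.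
(* The precision is t^(kd) because a product of d distances that is at most (t^k)^d has a factor at
   most t^k. *)
have [Q hQ] := choice (fun k => monic_approx mP (exprn_gt0 d (tk k))).
pose P_ k := map_poly h (Q k).
have P_m k : P_ k \is monic by have [? _ _] := hQ k; rewrite monic_map.
have P_d k i : abs (P`_i - (P_ k)`_i) <= (t ^+ k) ^+ d.
  by have [_ _] := hQ k; rewrite coef_map.
have tkd1 k : (t ^+ k) ^+ d <= 1 by rewrite -exprM exprn_ile1 ?ltW.
have P_i k : integral_poly (P_ k).
  move=> i; rewrite -[(P_ k)`_i](subKr P`_i); apply: absB_le => //.
  exact: le_trans (P_d k i) (tkd1 k).
have P_split k : exists2 rs, P_ k = \prod_(r <- rs) ('X - r%:P) & size rs = d.
  have [mQ sQ _] := hQ k; have [rs ers] := closed_field_poly_normal (Q k).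
  move: ers; rewrite (monicP mQ) scale1r => ers.
  exists (map h rs); first by rewrite /P_ ers rmorph_prod/= big_map;
    apply: eq_bigr => r _; rewrite rmorphB/= map_polyX map_polyC.
  have := congr1 (fun q : {poly Kbar} => size q) ers; rewrite sQ size_prod_XsubC => es.
  by rewrite size_map /d es.
have near k x : abs x <= 1 -> abs (P_ k.+1).[x] <= (t ^+ k) ^+ d ->
    exists y, root (P_ k.+1) y /\ abs (x - y) <= t ^+ k.
  move=> x1; have [rs -> srs] := P_split k.+1.
  case: (pselect (exists2 y, y \in rs & abs (x - y) <= t ^+ k)) => [[y yrs hy] _|no].
    by exists y; rewrite root_prod_XsubC.
  have far y : y \in rs -> t ^+ k < abs (x - y).
    by move=> yrs; case: ltP => // le; case: no; exists y.
  suff : (t ^+ k) ^+ d < abs (\prod_(r <- rs) ('X - r%:P)).[x] by move=> /lt_geF ->.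
  rewrite horner_prod (abs_prod Habs) -srs.
  have : (0 < size rs)%N by rewrite srs /d -subn1 subn_gt0.
  elim: rs far {srs no} => // r rs ih far _.
  rewrite big_cons /= exprS; have r_far := far r (mem_head _ _).
  case: rs ih far => [|r' rs] ih far.
    by rewrite big_nil expr0 !mulr1 !hornerE.
  rewrite ltr_pM// ?ltW ?exprn_gt0// ?hornerE//.
  by apply: ih => // y yrs; apply: far; rewrite inE yrs orbT.
(* Stated for every x, with the dummy value 0 at non-roots, so that [choice] provides a total
   function. *)
have step (kx : nat * C) : exists y, root (P_ kx.1) kx.2 ->
    root (P_ kx.1.+1) y /\ abs (kx.2 - y) <= t ^+ kx.1.
  case: kx => k x /=; case: (boolP (root (P_ k) x)) => [rx|_]; last by exists 0.
  have x1 := root_integral_le1 (P_m k) (P_i k) rx.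
  have [|y hy] := near k x x1; last by exists y.
  rewrite -[_.[x]]subr0 -[X in _ - X](rootP rx); apply: horner_coef_dist => // i.
  apply: (abs_dist_le Habs (y := P`_i)) => //.
  rewrite absB//; apply: le_trans (P_d _ _) _.
  by rewrite -!exprM ler_wiXn2l ?ltW// leq_mul2r leqnSn orbT.
have [g hg] := choice step.
have [x0 rx0] : exists x0, root (P_ 0) x0.
  have [[|r rs] e srs] := P_split 0%N.
    by move: sP; rewrite -subn_gt0 subn1 -/d -srs.
  by exists r; rewrite e root_prod_XsubC mem_head.
pose xs := fix xs k := if k is k'.+1 then g (k', xs k') else x0.
have rxs k : root (P_ k) (xs k).
  by elim: k => //= k ih; have [] := hg (k, xs k) ih.
have dxs k : abs (xs k.+1 - xs k) <= t ^+ k.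
  by rewrite absB//; have [] := hg (k, xs k) (rxs k).
have xs1 k : abs (xs k) <= 1 := root_integral_le1 (P_m k) (P_i k) (rxs k).
have hx := limit_geom Habs Hcomp (ltW t0) t1 dxs; set x := limit abs xs in hx.
have x1 : abs x <= 1.
  by rewrite -(subrK (xs 0%N) x); apply: absD_le => //; have := hx 0%N; rewrite expr0.
exists x; apply/rootP; apply: (abs_eq0_of_geom Habs (ltW t0) t1) => k.
rewrite -[P.[x]](subrK P.[xs k]); apply: absD_le => //.
  by apply: le_trans (hx k); exact: horner_dist.
rewrite -[_.[_]]subr0 -[X in _ - X](rootP (rxs k)); apply: le_trans (horner_coef_dist (P_d k) _) _ => //.
have d0 : (0 < d)%N by rewrite /d -subn1 subn_gt0.
by apply: ler_iXnr => //; rewrite ?exprn_ile1 ?ltW.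
Qed.

Lemma integral_poly_splits P : P \is monic -> integral_poly P ->
  exists rs, P = \prod_(r <- rs) ('X - r%:P).
Proof.
move: {2}(size P) (leqnn (size P)) => n; elim: n P => [|n ih] P sP mP iP.
  by move: sP; rewrite leqn0 size_poly_eq0 (negPf (monic_neq0 mP)).
have [s1|s1] := leqP (size P) 1.
  exists [::]; rewrite big_nil; have := size1_polyC s1 => e.
  by move: (mP); rewrite e monicE lead_coefC => /eqP ->.
have [x rx] := integral_poly_root mP iP s1.
have x1 := root_integral_le1 mP iP rx.
have [Q eQ] := factor_theorem _ _ rx.
have mQ : Q \is monic by rewrite -(monicMr Q (monicXsubC x)) -eQ.
have sQ : size P = (size Q).+1.
  by rewrite eQ size_Mmonic ?monic_neq0 ?monicXsubC// size_XsubC addn2.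
have cQ i : Q`_i = P`_i.+1 + x * Q`_i.+1.
  rewrite eQ mulrBr coefB coefMX/= coefMC; ring.
(* Descending induction from the top coefficient, through [cQ]. *)
have iQ : integral_poly Q.
  have down m : forall i, (size Q <= i + m)%N -> abs Q`_i <= 1.
    elim: m => [|m ihm] i; first by rewrite addn0 => h'; rewrite nth_default ?absE0.
    rewrite addnS -addSn => h'; rewrite cQ; apply: absD_le => //.
    by apply: absM_le1 => //; exact: ihm.
  by move=> i; apply: (down (size Q)); rewrite leq_addl.
have [|rs ers] := ih Q _ mQ iQ; first by rewrite sQ in sP.
by exists (x :: rs); rewrite big_cons -ers mulrC.
Qed.

End AlgebraicallyClosed.

(** * Closed subfields *)

Section Subfield.
Variable C : fieldType.

(** A closed subset of C has to become a [fieldType] of its own, since division and gcd of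
    polynomials over K1 are needed. *)
Record subfield_pred := SubfieldPred {
  subfield_mem :> {pred C};
  subfield_closed : divring_closed subfield_mem }.

HB.instance Definition _ (S : subfield_pred) :=
  GRing.isDivringClosed.Build C (subfield_mem S) (subfield_closed S).

Record subfield_of (S : subfield_pred) := SubfieldOf {
  subfield_val : C;
  subfield_valP : subfield_val \in subfield_mem S }.

HB.instance Definition _ S := [isSub for @subfield_val S].
HB.instance Definition _ S := [Choice of subfield_of S by <:].
HB.instance Definition _ S := [SubChoice_isSubIntegralDomain of subfield_of S by <:].
HB.instance Definition _ S := [SubIntegralDomain_isSubField of subfield_of S by <:].

Lemma subfield_exists (A : set C) : is_subring A -> (forall x, A x -> A x^-1) ->
  exists (K1 : fieldType) (i : {rmorphism K1 -> C}), range i = A.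
Proof.
case=> A0 A1 AN AD AM AV; pose P : {pred C} := fun x => `[< A x >].
have PE x : x \in P <-> A x by split=> [/asboolP//|h]; exact/asboolP.
have Pc : divring_closed P.
  split=> [|x y /PE hx /PE hy|x y /PE hx /PE hy]; apply/PE => //.
    by apply: AD => //; exact: AN.
  by apply: AM => //; exact: AV.
exists (subfield_of (SubfieldPred Pc)), \val; apply/seteqP; split=> [_ [x _ <-]|x Ax].
  by apply/PE; exact: (subfield_valP x).
by exists (@SubfieldOf (SubfieldPred Pc) x (proj2 (PE x) Ax)).
Qed.

End Subfield.

Section TopologicalClosure.
Variables (R : realType) (C : fieldType) (abs : C -> R).
Hypothesis Habs : is_nonarch_abs abs.

Definition tclosure (A : set C) : set C :=
  [set z | forall e : R, 0 < e -> exists2 s, A s & abs (z - s) < e].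

Lemma sub_tclosure A : A `<=` tclosure A.
Proof. by move=> x Ax e e0; exists x; rewrite // subrr absE0. Qed.

Lemma tclosure_lim A u l : (forall n : nat, tclosure A (u n)) -> abs_cvg abs u l ->
  tclosure A l.
Proof.
move=> hu hl e e0; have [N hN] := hl e e0; have [s As hs] := hu N e e0.
exists s => //; rewrite -(subrKA (u N)); apply: absD_lt => //.
by rewrite absB//; exact: hN.
Qed.

Lemma tclosure_approx A x e : tclosure A x -> x != 0 -> 0 < e ->
  exists s, [/\ A s, abs (x - s) < e & abs s = abs x].
Proof.
move=> hx x0 e0; have [|s As] := hx (Num.min e (abs x)).
  by rewrite lt_min e0 abs_gt0.
by rewrite lt_min => /andP[h1 h2]; exists s; split=> //; exact: abs_close_eq h2.
Qed.

(** This transfers discreteness of absolute values from a set to its closure. *)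
Lemma tclosure_abs A x : tclosure A x -> x != 0 -> exists2 s, A s & abs s = abs x.
Proof.
move=> hx x0; have [|s As hs] := hx (abs x); first by rewrite abs_gt0.
by exists s => //; exact: abs_close_eq hs.
Qed.

Lemma tclosure_subring A : is_subring A -> is_subring (tclosure A).
Proof.
case=> A0 A1 AN AD AM; split; try exact: sub_tclosure.
- move=> x hx e e0; have [s As hs] := hx e e0; exists (- s); first exact: AN.
  by rewrite -opprD absN.
- move=> x y hx hy e e0; have [s As hs] := hx e e0; have [t At ht] := hy e e0.
  exists (s + t); first exact: AD.
  by rewrite opprD addrACA; exact: absD_lt.
move=> x y hx hy e e0.
have [->|x0] := eqVneq x 0; first by exists 0; rewrite // mul0r subrr absE0.
have [->|y0] := eqVneq y 0; first by exists 0; rewrite // mulr0 subrr absE0.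
have ax : 0 < abs x by rewrite abs_gt0.
have ay : 0 < abs y by rewrite abs_gt0.
have [s [As hs _]] := tclosure_approx hx x0 (divr_gt0 e0 ay).
have [t [At ht et]] := tclosure_approx hy y0 (divr_gt0 e0 ax).
exists (s * t); first exact: AM.
have -> : x * y - s * t = x * (y - t) + t * (x - s) by ring.
by apply: absD_lt => //; rewrite (absM Habs) mulrC -ltr_pdivlMr ?et.
Qed.

Lemma tclosure_inv A : (forall x, A x -> A x^-1) -> forall x, tclosure A x -> tclosure A x^-1.
Proof.
move=> AV x hx e e0; have [x0|x0] := eqVneq x 0.
  have [s As hs] := hx e e0.
  rewrite x0 invr0 -x0; exact: hx.
have ax : 0 < abs x by rewrite abs_gt0.
have [s [As hs es]] := tclosure_approx hx x0 (mulr_gt0 e0 (mulr_gt0 ax ax)).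
exists s^-1; first exact: AV.
have s0 : s != 0 by rewrite -(abs_gt0 Habs) es.
have -> : x^-1 - s^-1 = (s - x) / (x * s) by field; rewrite x0 s0.
by rewrite (absM Habs) absV// (absM Habs) es absB// ltr_pdivrMr// mulr_gt0.
Qed.

End TopologicalClosure.

(** * Discreteness of absolute values *)

Section AttainedMax.
Variables (R : realType) (C : fieldType) (abs : C -> R).
Hypothesis Habs : is_nonarch_abs abs.

Lemma abs_sum_lt (I : Type) (s : seq I) (P : pred I) (f : I -> C) m :
  0 < m -> (forall i, P i -> abs (f i) < m) -> abs (\sum_(i <- s | P i) f i) < m.
Proof.
move=> m0 h; elim/big_rec: _ => [|i x Pi hx]; first by rewrite absE0.
exact: absD_lt (h _ Pi) hx.
Qed.

(** A maximum attained by one term only would be the absolute value of the sum. *)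
Lemma sum0_two_max n (t : 'I_n -> C) : \sum_k t k = 0 -> (exists k, t k != 0) ->
  exists k l : 'I_n, [/\ (k < l)%N, abs (t k) = abs (t l) & t k != 0].
Proof.
move=> s0 [k0 tk0].
case: (@Order.TotalTheory.arg_maxP _ _ 'I_n k0 xpredT (fun k => abs (t k)) isT) => m _ hm'.
have {hm'}hm k : abs (t k) <= abs (t m) := hm' k isT.
have tm0 : 0 < abs (t m) by apply: lt_le_trans (hm k0); rewrite abs_gt0.
have [k km ekm] : exists2 k, k != m & abs (t k) = abs (t m).
  case: (pselect (exists2 k, k != m & abs (t k) = abs (t m))) => // no.
  move: s0; rewrite (bigD1 m)//= => e.
  have := absD_dom Habs (_ : abs (\sum_(i < n | i != m) t i) < abs (t m)).
  rewrite e absE0// => h; have /h e0 : abs (\sum_(i < n | i != m) t i) < abs (t m).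
    apply: abs_sum_lt => // i im; rewrite lt_neqAle hm andbT.
    by apply/negP => /eqP e'; apply: no; exists i.
  by rewrite -e0 ltxx in tm0.
have tk0' : t k != 0 by rewrite -(abs_gt0 Habs) ekm.
case: (ltngtP k m) => [lt|lt|/val_inj e]; last by rewrite e eqxx in km.
  by exists k, m; split.
by exists m, k; split; rewrite // -(abs_gt0 Habs).
Qed.

Variables (K1 : fieldType) (i : {rmorphism K1 -> C}) (w : R).
Hypothesis w0 : 0 < w.
Hypothesis w1 : w < 1.
Hypothesis gap : forall x : K1, abs (i x) < 1 -> abs (i x) <= w.

(** Dimension at most n over K1, expressed by linear dependence so that V may be any subset of C. *)
Definition dim_le (n : nat) (V : set C) := forall x : 'I_n.+1 -> C, (forall k, V (x k)) ->
  exists2 a : 'I_n.+1 -> K1, (exists k, a k != 0) & \sum_k i (a k) * x k = 0.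

(** In a linear relation two terms have the same size, so |x_k| / |x_l| < 1 is an absolute value of
    K1, hence at most w; monotonicity extends this to the two ends. *)
Lemma dim_le_ratio n V (x : 'I_n.+1 -> C) : dim_le n V -> (forall k, V (x k)) ->
  (forall k, x k != 0) -> (forall k l : 'I_n.+1, (k < l)%N -> abs (x k) < abs (x l)) ->
  abs (x ord0) <= w * abs (x ord_max).
Proof.
move=> dV Vx x0 inc; have [a [k0 ak0] s0] := dV x Vx.
have [|k [l [kl e tk0]]] := sum0_two_max s0.
  by exists k0; rewrite mulf_neq0 ?fmorph_eq0.
have mono (k' l' : 'I_n.+1) : (k' <= l')%N -> abs (x k') <= abs (x l').
  by rewrite leq_eqVlt => /orP[/eqP/val_inj->//|/inc/ltW].
apply: le_trans (mono ord0 k (leq0n _)) _.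
apply: le_trans (_ : w * abs (x l) <= _); last first.
  by rewrite ler_pM2l//; apply: mono; rewrite -ltnS.
have al0 : a l != 0.
  apply: contraNneq tk0 => al; move: e; rewrite al rmorph0 mul0r absE0// => /eqP.
  by rewrite abs_eq0b.
have ak : a k != 0 by move: tk0; rewrite mulf_eq0 negb_or fmorph_eq0 => /andP[].
have ak' : 0 < abs (i (a k)) by rewrite abs_gt0// fmorph_eq0.
have xl : 0 < abs (x l) by rewrite abs_gt0.
have ratio : abs (i (a l / a k)) * abs (x l) = abs (x k).
  rewrite fmorph_div (absM Habs) absV// mulrAC -(absM Habs) -e (absM Habs).
  by rewrite mulrAC divff ?mul1r// gt_eqF.
rewrite -ratio ler_pM2r//; apply: gap.
by rewrite -(ltr_pM2r xl) ratio mul1r inc.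
Qed.

(** Otherwise there is an infinite strictly increasing chain of values |f(e_k)| <= 1. By
    [dim_le_ratio] every n steps of it gain a factor 1/w, so the first value is at most w^k for all
    k. *)
Lemma max_attained n V (f : nat -> C) : dim_le n V -> (forall m, tclosure abs V (f m)) ->
  integral1 abs f -> (exists m, f m != 0) ->
  exists2 d, f d != 0 & forall m, abs (f m) <= abs (f d).
Proof.
move=> dV Vf f1 [m0 fm0].
case: (pselect (exists2 d, f d != 0 & forall m, abs (f m) <= abs (f d))) => // no.
have next d : exists m, f d != 0 -> abs (f d) < abs (f m).
  case: (eqVneq (f d) 0) => [_|fd]; first by exists 0%N.
  case: (pselect (exists m, abs (f d) < abs (f m))) => [[m hm]|no']; first by exists m.
  case: no; exists d => // m; case: leP => // lt; case: no'; by exists m.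
have [nx hnx] := choice next; pose e k := iter k nx m0.
have e0 k : f (e k) != 0.
  elim: k => // k ih; rewrite -(abs_gt0 Habs); apply: lt_trans (hnx _ ih).
  by rewrite abs_gt0.
have inc k l : (k < l)%N -> abs (f (e k)) < abs (f (e l)).
  elim: l => // l ih; rewrite ltnS leq_eqVlt => /orP[/eqP->|/ih h]; first exact: hnx.
  exact: lt_trans h (hnx _ (e0 l)).
have [v hv] : exists v : nat -> C, forall k, V (v k) /\ abs (v k) = abs (f (e k)).
  suff /choice[v hv] : forall k, exists s, V s /\ abs s = abs (f (e k)) by exists v.
  move=> k; have [s Vs es] := tclosure_abs Habs (Vf (e k)) (e0 k).
  by exists s.
have jump k : abs (f (e k)) <= w * abs (f (e (k + n)%N)).
  have [_ ek] := hv k; have [_ ekn] := hv (k + n)%N; rewrite -ek -ekn.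
  have := @dim_le_ratio n V (fun j : 'I_n.+1 => v (k + j)%N) dV.
  rewrite /= addn0; apply.
  - by move=> j; case: (hv (k + j)%N).
  - by move=> j; rewrite -(abs_gt0 Habs); case: (hv (k + j)%N) => _ ->; rewrite abs_gt0.
  - move=> j l jl; case: (hv (k + j)%N) => _ ->; case: (hv (k + l)%N) => _ ->.
    by apply: inc; rewrite ltn_add2l.
have small k : abs (f m0) <= w ^+ k.
  suff : abs (f m0) <= w ^+ k * abs (f (e (k * n)%N)).
    by move=> /le_trans; apply; rewrite ler_piMr ?exprn_ge0 ?(ltW w0).
  elim: k => [|k ih]; first by rewrite mul1r.
  apply: le_trans ih _; rewrite exprSr -mulrA ler_pM2l ?exprn_gt0//.
  by rewrite mulSn addnC.
by move: fm0; rewrite (abs_eq0_of_geom Habs (ltW w0) w1 small) eqxx.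
Qed.

Lemma dim_leW n V V' : V' `<=` V -> dim_le n V -> dim_le n V'.
Proof. by move=> sub dV x hx; apply: dV => k; exact: sub. Qed.

(** Polynomials in u and v are reduced modulo P and Q. The remainders of n + 1 elements form a
    matrix with n columns, and a nonzero vector of its left kernel is the relation. *)
Lemma dim_le_span (P Q : {poly K1}) u v : P \is monic -> Q \is monic ->
  root (map_poly i P) u -> root (map_poly i Q) v ->
  dim_le ((size P).-1 + (size Q).-1)
    [set x | exists a b : {poly K1}, x = (map_poly i a).[u] + (map_poly i b).[v]].
Proof.
move=> mP mQ ru rv x hx; set n := (_ + _)%N.
have [a ha] := choice hx; have [b hb] := choice ha => {ha hx}.
pose M := \matrix_(k < n.+1, j < n)
  match split j with inl j => (a k %% P)`_j | inr j => (b k %% Q)`_j end.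
have : kermx M != 0.
  by rewrite kermx_eq0 /row_free ltn_eqF// ltnS rank_leq_col.
case/rowV0Pn => c /sub_kermxP cM c0.
have red (p D : {poly K1}) t : D \is monic -> root (map_poly i D) t ->
    (map_poly i (p %% D)).[t] = (map_poly i p).[t].
  move=> mD rt; rewrite [in RHS](divp_eq p D) rmorphD rmorphM hornerD hornerM/=.
  by rewrite (rootP rt) mulr0 add0r.
have cM' j : \sum_k c 0 k * M k j = 0 by have := congr1 (fun N : 'rV_n => N 0 j) cM; rewrite !mxE.
have small (D p : {poly K1}) j : D \is monic -> ((size D).-1 <= j)%N -> (p %% D)`_j = 0.
  move=> mD hj; apply: nth_default; apply: leq_trans hj.
  have : (size (p %% D)%R < size D)%N by rewrite ltn_modp monic_neq0.
  by case: (size D).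
have comb (D : {poly K1}) t (p : 'I_n.+1 -> {poly K1}) : D \is monic ->
    root (map_poly i D) t ->
    (forall j, (j < (size D).-1)%N -> \sum_k c 0 k * (p k %% D)`_j = 0) ->
    \sum_k i (c 0 k) * (map_poly i (p k)).[t] = 0.
  move=> mD rt hD; rewrite -[RHS](horner0 t) -(rmorph0 (map_poly i)).
  have <- : \sum_k c 0 k *: (p k %% D) = 0.
    apply/polyP => j; rewrite coef_sum coef0.
    under eq_bigr do rewrite coefZ.
    have [/hD//|ge] := ltnP j (size D).-1.
    by apply: big1 => k _; rewrite small// mulr0.
  rewrite rmorph_sum/= horner_sum; apply: eq_bigr => k _.
  by rewrite map_polyZ hornerZ red.
exists (fun k => c 0 k); first exact/rV0Pn.
under eq_bigr do rewrite hb mulrDr.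
rewrite big_split/= (comb P u a)// ?(comb Q v b)// ?addr0// => j hj.
- rewrite -[RHS](cM' (rshift _ (Ordinal hj))); apply: eq_bigr => k _; rewrite mxE.
  by rewrite (unsplitK (inr (Ordinal hj))).
- rewrite -[RHS](cM' (lshift _ (Ordinal hj))); apply: eq_bigr => k _; rewrite mxE.
  by rewrite (unsplitK (inl (Ordinal hj))).
Qed.

End AttainedMax.

(** * Zeros of bounded power series *)

Section SeriesZeros.
Variables (R : realType) (C : fieldType) (abs : C -> R).
Hypothesis Habs : is_nonarch_abs abs.
Hypothesis Hcomp : abs_complete abs.
Variables (Kbar : closedFieldType) (h : {rmorphism Kbar -> C}).
Hypothesis h_dense : forall (z : C) (e : R), 0 < e -> exists x : Kbar, abs (z - h x) < e.
Implicit Types (f : nat -> C) (x : C).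

Lemma first_max f : (exists2 d, f d != 0 & forall m, abs (f m) <= abs (f d)) ->
  exists d, [/\ f d != 0, forall m, abs (f m) <= abs (f d)
    & forall m, (m < d)%N -> abs (f m) < abs (f d)].
Proof.
case=> d0 fd0 hd0.
have ex : exists n, abs (f n) == abs (f d0) by exists d0.
have [d /eqP ed min] := ex_minnP ex.
exists d; rewrite -(abs_gt0 Habs) ed; split=> // [|m md]; first by rewrite abs_gt0.
rewrite lt_neqAle hd0 andbT; apply/negP => /min.
by rewrite leqNgt md.
Qed.

Lemma sev_scale c f x : integral1 abs f -> abs c <= 1 -> abs x < 1 ->
  sev abs (fun n => c * f n) x = c * sev abs f x.
Proof.
move=> fi c1 x1; apply: (sev_unique Habs (lexx _) x1) => N.
under eq_bigr do rewrite -mulrA.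
by rewrite -mulr_sumr -mulrBr; apply: absM_le => //; exact: sev_approx.
Qed.

Lemma sevB f g x : integral1 abs f -> integral1 abs g -> abs x < 1 ->
  sev abs (fun n => f n - g n) x = sev abs f x - sev abs g x.
Proof.
move=> fi gi x1; apply: (sev_unique Habs (lexx _) x1) => N.
under eq_bigr do rewrite mulrBl.
rewrite sumrB; have -> (a b c d : C) : a - b - (c - d) = (a - c) - (b - d) by ring.
by apply: absB_le => //; exact: sev_approx.
Qed.

Lemma sev_at0 f : integral1 abs f -> sev abs f 0 = f 0%N.
Proof.
move=> fi; apply: limitE => // e e0; exists 1%N => -[|N]// _.
rewrite big_ord_recl expr0 mulr1 big1 ?addr0 ?subrr ?absE0// => j _.
by rewrite expr0n mulr0.
Qed.

(** Preparation after division by the first coefficient of maximal size. The set A records where the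
    coefficients lie: all of C when zeros are only counted, K1 when P has to be defined over K1. *)
Lemma weierstrass_poly (A : set C) f d : is_subring A -> (forall x, A x -> A x^-1) ->
  (forall u l, (forall n, A (u n)) -> abs_cvg abs u l -> A l) ->
  (forall n, A (f n)) -> integral1 abs f -> f d != 0 ->
  (forall m, abs (f m) <= abs (f d)) -> (forall m, (m < d)%N -> abs (f m) < abs (f d)) ->
  exists P : {poly C},
  [/\ P \is monic, size P = d.+1, (forall i, A P`_i /\ abs P`_i <= 1),
     (forall x, root P x -> abs x < 1)
   & forall x, abs x < 1 -> root P x <-> sev abs f x = 0].
Proof.
move=> hA AV Alim fA fi fd0 fmax flow; have afd : 0 < abs (f d) by rewrite abs_gt0.
pose g n := f n / f d.
have ag n : abs (g n) = abs (f n) / abs (f d) by rewrite (absM Habs) absV.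
have gi : integral1 abs g by move=> n; rewrite ag ler_pdivrMr// mul1r.
have gA n : A (g n) by case: hA => _ _ _ _; apply => //; exact: AV.
have gd : abs (g d) = 1 by rewrite ag divff// gt_eqF.
have [w [w1 w0 glow]] : exists w : R, [/\ w < 1, 0 <= w &
    forall j, (j < d)%N -> abs (g j) <= w].
  (* Finitely many strict bounds, one for each index below d, have a common w < 1. *)
  suff aux e : (forall j, (j < e)%N -> abs (g j) < 1) ->
      exists w : R, [/\ w < 1, 0 <= w & forall j, (j < e)%N -> abs (g j) <= w].
    by apply: aux => j jd; rewrite ag ltr_pdivrMr// mul1r flow.
  elim: e => [|e ih] hg; first by exists 0; rewrite ltr01.
  have [w [w1 w0 hw]] := ih (fun j je => hg j (ltnW je)).
  exists (Num.max w (abs (g e))); rewrite gt_max w1 hg// le_max w0; split=> // j.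
  by rewrite ltnS leq_eqVlt le_max => /orP[/eqP->|/hw ->//]; rewrite lexx orbT.
have [P [mP sP PA Pr Pz]] := weierstrass_preparation Habs Hcomp hA
  (fun x Ax _ => AV x Ax) Alim gA gi gd w1 w0 glow.
exists P; split=> // x x1; rewrite Pz//.
have -> : sev abs f x = f d * sev abs g x.
  rewrite -sev_scale//; congr sev; apply/funext => n.
  by rewrite /g mulrCA divff ?mulr1.
by split => [->|/eqP]; rewrite ?mulr0// mulf_eq0 (negPf fd0) => /eqP.
Qed.

Lemma setT_subring : is_subring (@setT C). Proof. by []. Qed.

Lemma fiber_count f d (s : seq C) : integral1 abs f -> abs (f d) = 1 ->
  (forall m, (m < d)%N -> abs (f m) < 1) ->
  uniq s -> (forall x, x \in s -> abs x < 1 /\ sev abs f x = 0) -> (size s <= d)%N.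
Proof.
move=> fi fd flow us hs.
have fd0 : f d != 0 by rewrite -(abs_gt0 Habs) fd ltr01.
have [//|//|//|||] := @weierstrass_poly setT f d setT_subring _ _ _ fi fd0.
- by move=> m; rewrite fd.
- by move=> m; rewrite fd; exact: flow.
move=> P [mP sP _ _ Pz].
rewrite -ltnS -sP; apply: max_poly_roots; rewrite ?monic_neq0//.
by apply/allP => x /hs[x1 /(Pz _ x1)].
Qed.

Lemma zeros_finite f : integral1 abs f ->
  (exists2 d, f d != 0 & forall m, abs (f m) <= abs (f d)) ->
  exists s : seq C, forall x, abs x < 1 -> sev abs f x = 0 -> x \in s.
Proof.
move=> fi /first_max[d [fd0 fmax flow]].
have [//|//|//|P [mP sP Pi _ Pz]] := @weierstrass_poly setT f d setT_subring _ _ _ fi fd0 fmax flow.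
have [|rs ers] := integral_poly_splits Habs Hcomp h_dense mP.
  by move=> k; case: (Pi k).
by exists rs => x x1 /(Pz x x1); rewrite ers root_prod_XsubC.
Qed.

Variables (K1 : fieldType) (i : {rmorphism K1 -> C}) (w : R).
Hypothesis i_lim : forall u l, (forall n, range i (u n)) -> abs_cvg abs u l -> range i l.
Hypothesis w0 : 0 < w.
Hypothesis w1 : w < 1.
Hypothesis gap : forall x : K1, abs (i x) < 1 -> abs (i x) <= w.

Lemma range_subring : is_subring (range i).
Proof.
split; first by exists 0; rewrite ?rmorph0.
- by exists 1; rewrite ?rmorph1.
- by move=> _ [x _ <-]; exists (- x); rewrite ?rmorphN.
- by move=> _ _ [x _ <-] [y _ <-]; exists (x + y); rewrite ?rmorphD.
- by move=> _ _ [x _ <-] [y _ <-]; exists (x * y); rewrite ?rmorphM.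
Qed.

Lemma range_inv x : range i x -> range i x^-1.
Proof. by case=> y _ <-; exists y^-1; rewrite ?fmorphV. Qed.

(** The bound 2 instead of 1 comes from taking u = v = 0 and P = Q = X in [dim_le_span]; only
    finiteness matters. *)
Lemma range_dim_le : dim_le i 2 (range i).
Proof.
have rX : root (map_poly i 'X) 0 by rewrite map_polyX rootX.
have := dim_le_span (monicX K1) (monicX K1) rX rX.
rewrite !size_polyX => /dim_leW; apply.
by move=> _ [a _ <-]; exists a%:P, 0; rewrite map_polyC hornerC rmorph0 horner0 addr0.
Qed.

Lemma series_max f : (forall n, range i (f n)) -> integral1 abs f -> (exists m, f m != 0) ->
  exists2 d, f d != 0 & forall m, abs (f m) <= abs (f d).
Proof.
move=> fA fi fn0; apply: (max_attained Habs w0 w1 gap range_dim_le) => // m.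
exact/sub_tclosure.
Qed.

Lemma series_poly f : (forall n, range i (f n)) -> integral1 abs f -> (exists m, f m != 0) ->
  exists P : {poly K1},
  [/\ P \is monic, integral_poly abs (map_poly i P),
     (forall x, root (map_poly i P) x -> abs x < 1)
   & forall x, abs x < 1 -> root (map_poly i P) x <-> sev abs f x = 0].
Proof.
move=> fA fi fn0; have [d [fd0 fmax flow]] := first_max (series_max fA fi fn0).
have [P [mP sP PA Pr Pz]] := weierstrass_poly range_subring range_inv i_lim fA fi fd0 fmax flow.
have [g hg] : exists g : nat -> K1, forall k, i (g k) = P`_k.
  suff /choice[g hg] : forall k, exists a, i a = P`_k by exists g.
  by move=> k; have [[a _ <-] _] := PA k; exists a.
pose Q := \poly_(k < size P) g k.
have eQ : map_poly i Q = P.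
  apply/polyP => k; rewrite coef_map coef_poly; case: ltnP => hk; first exact: hg.
  by rewrite [P`_k]nth_default//; exact: rmorph0.
exists Q; rewrite eQ; split=> // [|k]; last by case: (PA k).
by rewrite -(map_monic i) eQ.
Qed.

(* The coefficients of f lie in the closure of a finite-dimensional K1-space,
   which suffices for their absolute values to be discrete. *)
Lemma series_eq0 n V f : dim_le i n V -> (forall m, tclosure abs V (f m)) ->
  integral1 abs f ->
  (forall s : seq C, exists x, [/\ x \notin s, abs x < 1 & sev abs f x = 0]) ->
  forall m, f m = 0.
Proof.
move=> dV fV fi inf m; apply/eqP; case: eqP => // /eqP fm.
have [|s hs] := zeros_finite fi.
  by apply: (max_attained Habs w0 w1 gap dV) => //; exists m.
by have [x [/negP xs x1 /(hs x x1)]] := inf s.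
Qed.

End SeriesZeros.

(** * Conjugates over K1 *)

Section ConjugateZeros.
Variables (R : realType) (C : fieldType) (abs : C -> R).
Hypothesis Habs : is_nonarch_abs abs.
Hypothesis Hcomp : abs_complete abs.
Variables (Kbar : closedFieldType) (h : {rmorphism Kbar -> C}).
Hypothesis h_dense : forall (z : C) (e : R), 0 < e -> exists x : Kbar, abs (z - h x) < e.
Variables (K1 : fieldType) (i : {rmorphism K1 -> C}) (w : R).
Hypothesis i_lim : forall u l, (forall n, range i (u n)) -> abs_cvg abs u l -> range i l.
Hypothesis w0 : 0 < w.
Hypothesis w1 : w < 1.
Hypothesis gap : forall x : K1, abs (i x) < 1 -> abs (i x) <= w.
Hypothesis char0 : forall n, (0 < n)%N -> n%:R != 0 :> C.

Lemma min_poly_exists z (Q : {poly K1}) : Q != 0 -> root (map_poly i Q) z ->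
  exists P : {poly K1}, [/\ P \is monic, root (map_poly i P) z &
    forall S : {poly K1}, S != 0 -> root (map_poly i S) z -> (size P <= size S)%N].
Proof.
move=> Q0 Qz; pose T n := `[< exists S : {poly K1}, [/\ S != 0, root (map_poly i S) z & size S = n] >].
have ex : exists n, T n by exists (size Q); apply/asboolP; exists Q.
have [n /asboolP[P [P0 Pz sP]] min] := ex_minnP ex.
have lP : lead_coef P != 0 by rewrite lead_coef_eq0.
exists ((lead_coef P)^-1 *: P); split.
- by rewrite monicE lead_coefZ mulVf.
- by rewrite map_polyZ rootE hornerZ (rootP Pz) mulr0.
- by move=> S S0 Sz; rewrite size_scale ?invr_eq0// sP; apply: min; apply/asboolP; exists S.
Qed.

(** To be used with [p^(n+1)]_F, [p^l]_G and [p^n]_F. The minimal polynomial P of z over K1 divides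
    the Weierstrass polynomials of f1 and f2 and is prime to that of f3, so its roots share the
    properties of z. Their product is P(0) up to sign, an element of K1. *)
Lemma conjugate_zeros (f1 f2 f3 : nat -> C) z :
  (forall n, range i (f1 n)) -> integral1 abs f1 -> (exists m, f1 m != 0) ->
  (forall n, range i (f2 n)) -> integral1 abs f2 -> (exists m, f2 m != 0) ->
  (forall n, range i (f3 n)) -> integral1 abs f3 -> (exists m, f3 m != 0) ->
  abs z < 1 -> sev abs f1 z = 0 -> sev abs f2 z = 0 -> sev abs f3 z <> 0 ->
  exists rs : seq C, [/\ uniq rs,
    forall o, o \in rs ->
      [/\ abs o < 1, sev abs f1 o = 0, sev abs f2 o = 0 & sev abs f3 o <> 0]
    & \prod_(o <- rs) abs o <= w].
Proof.
move=> A1 i1 n1 A2 i2 n2 A3 i3 n3 z1 z_1 z_2 z_3.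
have [P1 [mP1 iP1 rP1 zP1]] := series_poly Habs Hcomp i_lim w0 w1 gap A1 i1 n1.
have [P2 [mP2 iP2 rP2 zP2]] := series_poly Habs Hcomp i_lim w0 w1 gap A2 i2 n2.
have [P3 [mP3 iP3 rP3 zP3]] := series_poly Habs Hcomp i_lim w0 w1 gap A3 i3 n3.
have P1z := (zP1 z z1).2 z_1; have P2z := (zP2 z z1).2 z_2.
have [P [mP Pz minP]] := min_poly_exists (monic_neq0 mP1) P1z.
have P0 := monic_neq0 mP.
have dvdP S : root (map_poly i S) z -> P %| S.
  move=> Sz; rewrite /dvdp; apply/negPn/negP => r0.
  have : (size P <= size (S %% P)%R)%N.
    apply: minP => //; move: Sz; rewrite {1}(divp_eq S P) rmorphD rmorphM /=.
    by rewrite /root hornerD hornerM (rootP Pz) mulr0 add0r.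
  by rewrite leqNgt ltn_modp P0.
(* If D = gcd(P, S) were not constant, P / D would vanish at z and have smaller degree than P. *)
have coP S : ~ root (map_poly i S) z -> coprimep P S.
  move=> Sz; set D := gcdp P S.
  have D0 : D != 0 by rewrite gcdp_eq0 (negPf P0).
  have Dz : ~ root (map_poly i D) z.
    have /dvdpP[q eq] : D %| S := dvdp_gcdr P S.
    by move=> Dz; apply: Sz; rewrite eq rmorphM rootM/= Dz orbT.
  have /dvdpP[q eq] : D %| P := dvdp_gcdl P S.
  have q0 : q != 0 by apply: contraNneq P0 => q0; rewrite eq q0 mul0r.
  have /minP -/(_ q0) : root (map_poly i q) z.
    by move: Pz; rewrite {1}eq rmorphM rootM/= => /orP[//|/Dz].
  rewrite [in X in (X <= _)%N]eq size_mul// /coprimep -/D.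
  have : (0 < size D)%N by rewrite size_poly_gt0.
  have : (0 < size q)%N by rewrite size_poly_gt0.
  move: (size D) (size q); clear => -[|[|a]] [|b] //= _ _.
  by rewrite !addnS /= ltnS ltnNge leq_addr.
have [rs1 ers1] := integral_poly_splits Habs Hcomp h_dense (monic_map i mP1) iP1.
have : map_poly i P %| \prod_(r <- rs1) ('X - r%:P) by rewrite -ers1 dvdp_map dvdP.
case/dvdp_prod_XsubC => m; set rs := mask m rs1 => /eqpP eP.
have {}eP : map_poly i P = \prod_(r <- rs) ('X - r%:P).
  apply/eqP; rewrite -eqp_monic ?monic_map ?monic_prod_XsubC//; exact/eqpP.
have rsP o : (o \in rs) = root (map_poly i P) o by rewrite eP root_prod_XsubC.
have rs_of S o : P %| S -> o \in rs -> root (map_poly i S) o.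
  by rewrite rsP => /dvdpP[q ->] ro; rewrite rmorphM rootM/= ro orbT.
have rs_lt o : o \in rs -> abs o < 1.
  by move=> ors; apply: rP1; apply: rs_of ors; exact: dvdP.
have zin : z \in rs by rewrite rsP.
exists rs; split.
(* The conjugates are distinct since P is prime to its derivative, which is nonzero in
   characteristic 0 and too small in degree to vanish at z. *)
- rewrite -separable_prod_XsubC -eP separable_map separable_poly.unlock; apply: coP => dz.
  have : (0 < size P)%N by rewrite size_poly_gt0.
  have [sP|sP] := leqP (size P) 1.
    move: Pz; have e := size1_polyC sP; rewrite e map_polyC rootC fmorph_eq0 => /eqP c0 _.
    by move: P0; rewrite e c0 eqxx.
  have d0 : P^`() != 0.
    have [n eP'] : exists n, size P = n.+2 by exists (size P).-2; case: (size P) sP => [|[]].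
    apply: contraNneq P0 => /(congr1 (fun q : {poly K1} => q`_n)).
    rewrite coef_deriv coef0 -lead_coef_eq0 lead_coefE eP' => /eqP.
    by rewrite -mulr_natr mulf_eq0 -[n.+1%:R == 0](fmorph_eq0 i) rmorph_nat (negPf (char0 _))// orbF.
  by have := minP _ d0 dz; rewrite leqNgt lt_size_deriv.
- move=> o ors; have o1 := rs_lt o ors; split=> //.
  + by apply/(zP1 o o1)/rs_of => //; exact: dvdP.
  + by apply/(zP2 o o1)/rs_of => //; exact: dvdP.
  + move/(zP3 o o1) => r3; have : coprimep P P3 by apply: coP => /(zP3 z z1)/z_3.
    rewrite -(coprimep_map i) => /coprimep_root; move/(_ o).
    by rewrite (rootP r3) eqxx -rsP => /(_ ors).
rewrite -(abs_prod Habs).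
have eprod : abs (\prod_(o <- rs) o) = abs (i P.[0]).
  rewrite -horner_map eP horner_prod !(abs_prod Habs) rmorph0.
  by apply: eq_bigr => o _; rewrite hornerXsubC sub0r absN.
(* The list contains z, so the product is not empty and is indeed < 1. *)
rewrite eprod; apply: gap; rewrite -eprod (abs_prod Habs).
have : forall o, o \in rs -> abs o < 1 by exact: rs_lt.
case: rs zin {rsP rs_of rs_lt eprod eP} => // o rs _.
elim: rs o => [|o' rs ih] o hlt; first by rewrite big_seq1 hlt ?mem_head.
rewrite big_cons mulr_ilt1 ?(abs_ge0 Habs)//.
- by apply: prodr_ge0 => ? _; exact: abs_ge0.
- by rewrite hlt ?mem_head.
- by apply: ih => o'' oin; apply: hlt; rewrite inE oin orbT.
Qed.

End ConjugateZeros.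

(** * Torsion points *)

Lemma fiber_size (T U : eqType) (g : T -> U) (us : seq U) (s : seq T) k :
  (forall x, x \in s -> g x \in us) ->
  (forall v, v \in us -> (count (fun x => g x == v) s <= k)%N) ->
  (size s <= k * size us)%N.
Proof.
elim: us s => [|u us ih] s hs hk.
  by case: s hs {hk} => // x s /(_ x (mem_head _ _)).
rewrite mulnS -(count_predC (fun x => g x == u)) leq_add//.
  by apply: hk; exact: mem_head.
rewrite -size_filter; apply: ih => [x|v vus].
  rewrite mem_filter /= => /andP[gxu /hs].
  by rewrite inE (negPf gxu).
apply: leq_trans (hk v _); last by rewrite inE vus orbT.
by rewrite count_filter; apply: sub_count => x /andP[].
Qed.

Section Torsion.
Variables (R : realType) (C : fieldType) (abs : C -> R).
Hypothesis Habs : is_nonarch_abs abs.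
Hypothesis Hcomp : abs_complete abs.
Variables (Kbar : closedFieldType) (h : {rmorphism Kbar -> C}).
Hypothesis h_dense : forall (z : C) (e : R), 0 < e -> exists x : Kbar, abs (z - h x) < e.
Variables (K1 : fieldType) (i : {rmorphism K1 -> C}) (w : R).
Hypothesis i_lim : forall u l, (forall n, range i (u n)) -> abs_cvg abs u l -> range i l.
Hypothesis w0 : 0 < w.
Hypothesis w1 : w < 1.
Hypothesis gap : forall x : K1, abs (i x) < 1 -> abs (i x) <= w.
Variable p : nat.
Hypothesis p_prime : prime p.
Hypothesis p_lt1 : abs p%:R < 1.
Hypothesis p_neq0 : p%:R != 0 :> C.
Hypothesis abs_coprime : forall n, coprime p n -> abs n%:R = 1.
Variable F : series2 C.
Hypothesis F_int : integral2 abs F.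
Hypothesis F_fgl : is_formal_group_law F.
Hypothesis F_in : forall k l, range i (F k l).

Local Notation "x <+> y" := (fev abs F x y) (at level 45, left associativity).
Local Notation "n <.> x" := (fg_mul (fun z : C => z) abs F n x) (at level 40).

Definition tors : set C := Tors (fun z : C => z) abs F.

Let p_gt0 : 0 < abs p%:R. Proof. by rewrite abs_gt0. Qed.

Lemma pow_neq0 n : (p ^ n)%:R != 0 :> C.
Proof. by rewrite natrX expf_neq0. Qed.

Lemma abs_mulp_le x r : abs x < 1 -> abs x <= r ->
  abs (p <.> x) <= Num.max (abs p%:R) r * abs x.
Proof.
move=> x1 xr; rewrite -(subrK (p%:R * x) (p <.> x)); apply: absD_le => //.
  apply: le_trans (fg_mul_approx Habs Hcomp F_int F_fgl p x1) _.
  by rewrite expr2 ler_wpM2r ?(abs_ge0 Habs)// le_max xr orbT.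
by rewrite (absM Habs) ler_wpM2r ?(abs_ge0 Habs)// le_max lexx.
Qed.

Lemma mul_pS n x : abs x < 1 -> (p ^ n.+1) <.> x = p <.> ((p ^ n) <.> x).
Proof. by move=> x1; rewrite expnS (fg_mulM Habs Hcomp F_int F_fgl). Qed.

Lemma mul_pSr n x : abs x < 1 -> (p ^ n.+1) <.> x = (p ^ n) <.> (p <.> x).
Proof. by move=> x1; rewrite expnSr (fg_mulM Habs Hcomp F_int F_fgl). Qed.

Lemma mul_pD m n x : abs x < 1 -> (p ^ (m + n)) <.> x = (p ^ m) <.> ((p ^ n) <.> x).
Proof. by move=> x1; rewrite expnD (fg_mulM Habs Hcomp F_int F_fgl). Qed.

Lemma abs_mul_lt1 n x : abs x < 1 -> abs (n <.> x) < 1.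
Proof. exact: fg_mul_lt1. Qed.

Lemma tors_lt1 x : tors x -> abs x < 1. Proof. by case. Qed.

(** If m is prime to p then |m| = 1, so [m](y) = m y + O(y^2) vanishes only at y = 0: all torsion is
    p-power torsion. *)
Lemma tors_p x : tors x -> exists n, (p ^ n) <.> x = 0.
Proof.
case=> x1 [n [n0 nx]]; have [m pm en] := pfactor_coprime p_prime n0.
exists (logn p n); set y := _ <.> x.
have y1 : abs y < 1 by exact: abs_mul_lt1.
have my : m <.> y = 0 by rewrite /y -(fg_mulM Habs Hcomp F_int F_fgl)// -en.
have := fg_mul_approx Habs Hcomp F_int F_fgl m y1.
rewrite my sub0r absN// (absM Habs) abs_coprime// mul1r expr2.
case: (eqVneq y 0) => // yn0; rewrite -(abs_gt0 Habs) in yn0.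
by rewrite leNgt gtr_pMl// y1.
Qed.

Lemma pow_tors n x : abs x < 1 -> (p ^ n) <.> x = 0 -> tors x.
Proof. by move=> x1 e; split=> //; exists (p ^ n)%N; rewrite expn_gt0 prime_gt0. Qed.

Lemma tors_mul n x : tors x -> tors (n <.> x).
Proof.
move=> tx; have [m hm] := tors_p tx; have x1 := tors_lt1 tx.
apply: (@pow_tors m); first exact: abs_mul_lt1.
by rewrite -(fg_mulM Habs Hcomp F_int F_fgl)// mulnC (fg_mulM Habs Hcomp F_int F_fgl)// hm fg_mul0.
Qed.

(** On the disc |x| < |p| the linear term dominates, so [p] maps nonzero points of this disc to
    nonzero points of it. *)
Lemma tors_small x : tors x -> abs x < abs p%:R -> x = 0.
Proof.
move=> tx xp; have x1 := tors_lt1 tx; have [n] := tors_p tx.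
have step y : abs y < abs p%:R -> y != 0 -> abs (p <.> y) < abs p%:R /\ p <.> y != 0.
  move=> yp y0; have y1 := lt_trans yp p_lt1; have ay : 0 < abs y by rewrite abs_gt0.
  have e : abs (p <.> y) = abs (p%:R * y).
    apply: (abs_close_eq Habs); rewrite absB//.
    apply: le_lt_trans (fg_mul_approx Habs Hcomp F_int F_fgl p y1) _.
    by rewrite (absM Habs) expr2 ltr_pM2r.
  rewrite -(abs_gt0 Habs) e (absM Habs); split; last exact: mulr_gt0.
  by rewrite gtr_pMr.
case: (eqVneq x 0) => // x0 h0.
have : abs ((p ^ n) <.> x) < abs p%:R /\ (p ^ n) <.> x != 0.
  elim: n {h0} => [|n [ih1 ih2]]; first by rewrite expn0 fg_mulS /fg_mul/= fev0.
  by rewrite mul_pS//; exact: step.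
by case=> _; rewrite h0 eqxx.
Qed.

(** [p] shrinks the disc of radius r by the factor max(|p|, r), so a fixed number t of steps leads
    into the disc of [tors_small]. *)
Lemma tors_ball r : r < 1 -> exists t, forall x, tors x -> abs x <= r -> (p ^ t) <.> x = 0.
Proof.
move=> r1; pose l := Num.max (abs p%:R) r.
have l1 : l < 1 by rewrite gt_max p_lt1.
have l0 : 0 <= l by rewrite le_max (abs_ge0 Habs).
have [t ht] := exp_small l0 l1 p_gt0.
exists t => x tx xr; have x1 := tors_lt1 tx.
apply: tors_small; first exact: tors_mul.
apply: le_lt_trans ht; elim: t => [|t ih].
  by rewrite expn0 expr0 ltW// abs_mul_lt1.
rewrite mul_pS// exprS.
apply: le_trans (abs_mulp_le (abs_mul_lt1 _ x1) (_ : _ <= r)) _.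
  exact: le_trans (fg_mul_le Habs Hcomp F_int F_fgl _ x1) xr.
by rewrite ler_wpM2l.
Qed.

Lemma mul_coef_pow_range n m : range i (mul_coef F (p ^ n) m).
Proof. by apply: mul_coef_in F_in; exact: range_subring. Qed.

Lemma mul_coef_pow_int n : integral1 abs (mul_coef F (p ^ n)).
Proof. exact: integral1_mul_coef. Qed.

Lemma mul_coef_pow_neq0 n : exists m, mul_coef F (p ^ n) m != 0.
Proof. by exists 1%N; rewrite mul_coef1// pow_neq0. Qed.

Lemma pow_tors_finite n : exists s : seq C,
  forall x, abs x < 1 -> (p ^ n) <.> x = 0 -> x \in s.
Proof.
have [s hs] := zeros_finite Habs Hcomp h_dense (mul_coef_pow_int n)
  (series_max Habs w0 w1 gap (mul_coef_pow_range n) (mul_coef_pow_int n) (mul_coef_pow_neq0 n)).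
by exists s => x x1; rewrite (fg_mul_sev Habs Hcomp F_int F_fgl)//; exact: hs.
Qed.

Lemma tors_ball_finite r : r < 1 ->
  exists s : seq C, forall x, tors x -> abs x <= r -> x \in s.
Proof.
move=> r1; have [t ht] := tors_ball r1; have [s hs] := pow_tors_finite t.
by exists s => x tx xr; apply: hs; [exact: tors_lt1|exact: ht].
Qed.

Lemma abs_sev_le (f : nat -> C) x m : integral1 abs f -> abs x < 1 ->  0 <= m ->
  (forall n, abs (f n * x ^+ n) <= m) -> abs (sev abs f x) <= m.
Proof.
move=> fi x1 m0 hm; have := sev_approx Habs Hcomp fi (lexx (abs x)) x1.
move/(abs_le_of_approx Habs (abs_ge0 Habs x) x1); apply => N.
exact: abs_sum_le.
Qed.

Definition tors_infinite := forall s : seq C, exists2 x, tors x & x \notin s.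

(* The index q is p^(height of F). *)
Lemma finite_height : tors_infinite -> exists q, [/\ (1 < q)%N, abs (mul_coef F p q) = 1
  & forall m, (m < q)%N -> abs (mul_coef F p m) <= w].
Proof.
move=> inf; have ain m : range i (mul_coef F p m) := mul_coef_pow_range 1 m.
have aint : integral1 abs (mul_coef F p) := mul_coef_pow_int 1.
have le_w m : abs (mul_coef F p m) < 1 -> abs (mul_coef F p m) <= w.
  by case: (ain m) => y _ <-; exact: gap.
have [q [aq0 amax alow]] := first_max Habs (series_max Habs w0 w1 gap ain aint (mul_coef_pow_neq0 1)).
case: (ltP (abs (mul_coef F p q)) 1) => [lt|ge].
  (* If all coefficients are small, they are at most w and [p] contracts the whole disc by w; then a
     single p^t kills all torsion, which is finite. *)
  have contr x : abs x < 1 -> abs (p <.> x) <= w * abs x.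
    move=> x1; rewrite (fg_mul_sev Habs Hcomp F_int F_fgl)//.
    apply: abs_sev_le => // [|[|n]]; first by rewrite mulr_ge0 ?(abs_ge0 Habs) ?ltW.
      by rewrite mul_coef0// mul0r absE0// mulr_ge0 ?(abs_ge0 Habs) ?ltW.
    rewrite (absM Habs) ler_pM ?(abs_ge0 Habs)//.
      by apply: le_w; exact: le_lt_trans (amax _) lt.
    by rewrite absX// ler_iXnr// ?(abs_ge0 Habs)// ltW.
  have [t ht] := exp_small (ltW w0) w1 p_gt0.
  have [s hs] := pow_tors_finite t.
  have [x tx /negP[]] := inf s; have x1 := tors_lt1 tx; apply: hs => //.
  apply: tors_small; first exact: tors_mul.
  apply: le_lt_trans ht; elim: t => [|t ih].
    by rewrite expn0 expr0 ltW// abs_mul_lt1.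
  rewrite mul_pS// exprS; apply: le_trans (contr _ (abs_mul_lt1 _ x1)) _.
  by rewrite ler_wpM2l// ltW.
have aq : abs (mul_coef F p q) = 1 by apply/eqP; rewrite eq_le aint.
exists q; split=> // [|m mq]; last by apply: le_w; rewrite -[X in _ < X]aq; exact: alow.
(* The coefficients of index 0 and 1 are 0 and p, neither of absolute value 1; hence q > 1. *)
case: q aq {aq0 amax alow ge} => [|[|q]]// => [|e].
  by rewrite mul_coef0// absE0// => /eqP; rewrite eq_sym oner_eq0.
by move: p_lt1; rewrite -e mul_coef1// ltxx.
Qed.

Section Height.
Variable q : nat.
Hypothesis q_gt1 : (1 < q)%N.
Hypothesis aq : abs (mul_coef F p q) = 1.
Hypothesis alow : forall m, (m < q)%N -> abs (mul_coef F p m) <= w.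

(** Subtracting v with |v| < 1 from [p](X) leaves q as the first index of a unit coefficient. *)
Lemma mulp_fiber v (s : seq C) : abs v < 1 -> uniq s ->
  (forall x, x \in s -> abs x < 1 /\ p <.> x = v) -> (size s <= q)%N.
Proof.
move=> v1 us hs; pose g n := (v%:P : {poly C})`_n.
have aint : integral1 abs (mul_coef F p) := mul_coef_pow_int 1.
have gi : integral1 abs g.
  by move=> n; rewrite /g coefC; case: ifP => _; rewrite ?absE0// ltW.
apply: (@fiber_count _ _ _ Habs Hcomp (fun n => mul_coef F p n - g n)) us _ => //.
- by move=> n; exact: absB_le.
- by rewrite /g coefC gtn_eqF ?subr0// ltnW.
- move=> m mq; apply: absB_lt => //; first exact: le_lt_trans (alow mq) w1.
  by rewrite /g coefC; case: ifP => _; rewrite ?absE0.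
- move=> x /hs[x1 e]; split=> //.
  by rewrite sevB// sev_poly// hornerC -(fg_mul_sev Habs Hcomp F_int F_fgl)// e subrr.
Qed.

Lemma pow_tors_count n (s : seq C) : uniq s ->
  (forall x, x \in s -> abs x < 1 /\ (p ^ n) <.> x = 0) -> (size s <= q ^ n)%N.
Proof.
elim: n s => [|n ih] s us hs.
  have {}hs : {subset s <= [:: 0]}.
    by move=> x /hs[_]; rewrite expn0 fg_mulS /fg_mul/= fev0// => ->; rewrite mem_head.
  exact: uniq_leq_size us hs.
pose us' := undup [seq p <.> x | x <- s].
have : (size us' <= q ^ n)%N.
  apply: ih; first exact: undup_uniq.
  move=> y; rewrite mem_undup => /mapP[x /hs[x1 e] ->].
  by rewrite abs_mul_lt1// -mul_pSr.
rewrite expnS -(leq_pmul2l (ltnW q_gt1)); apply: leq_trans.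
apply: (@fiber_size _ _ (fun x => p <.> x)) => [x xs|v].
  by rewrite mem_undup; exact: map_f.
rewrite mem_undup => /mapP[x0 /hs[x01 _] ->].
rewrite -size_filter; apply: (@mulp_fiber (p <.> x0)); first exact: abs_mul_lt1.
  exact: filter_uniq.
by move=> x; rewrite mem_filter => /andP[/eqP -> /hs[]].
Qed.

(** The choice s0 = 1 - (1 - w)/q works by Bernoulli's inequality. Beyond this radius |x|^q bounds
    all terms of [p](x); [gap_extension] uses s0 as a substitute for a root of w. *)
Lemma exists_radius : exists s0 : R, [/\ 0 < s0, s0 < 1 & w <= s0 ^+ q.-1].
Proof.
have bern (e : R) n : 0 <= e -> e <= 1 -> 1 - n%:R * e <= (1 - e) ^+ n.
  move=> e0 e1; elim: n => [|n ih]; first by rewrite mul0r subr0 expr0.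
  rewrite exprS; apply: le_trans (_ : (1 - e) * (1 - n%:R * e) <= _); last first.
    by rewrite ler_wpM2l// subr_ge0.
  rewrite -natr1; have : 0 <= n%:R * (e * e) by rewrite !mulr_ge0 ?ler0n.
  by move: (n%:R : R) => k; nra.
pose e : R := (1 - w) / q%:R.
have q0 : 0 < q%:R :> R by rewrite ltr0n ltnW.
have e0 : 0 < e by rewrite divr_gt0// subr_gt0.
have qe : q%:R * e = 1 - w by rewrite mulrC divfK// gt_eqF.
have e1 : e < 1.
  by rewrite ltr_pdivrMr// mul1r (@lt_trans _ _ 1)// ?ltr1n// ltrBlDr ltrDl.
exists (1 - e); rewrite subr_gt0 e1 ltrBlDr ltrDl e0; split=> //.
apply: le_trans (bern e q.-1 (ltW e0) (ltW e1)).
by rewrite lerBrDr -lerBrDl -qe ler_pM2r// ler_nat leq_pred.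
Qed.

(** A term of degree between 1 and q - 1 is at most w |x|, and w <= s0^(q-1) <= |x|^(q-1). *)
Lemma abs_mulp_above s0 x : 0 < s0 -> w <= s0 ^+ q.-1 -> abs x < 1 -> s0 < abs x ->
  abs (p <.> x) <= abs x ^+ q.
Proof.
move=> s00 ws x1 sx; rewrite (fg_mul_sev Habs Hcomp F_int F_fgl)//.
have x0 := abs_ge0 Habs x; have aint : integral1 abs (mul_coef F p) := mul_coef_pow_int 1.
apply: abs_sev_le => //; first by rewrite exprn_ge0.
move=> n; rewrite (absM Habs) absX//; have [nq|qn] := ltnP n q; last first.
  apply: le_trans (_ : 1 * abs x ^+ n <= _); first by rewrite ler_wpM2r ?exprn_ge0.
  by rewrite mul1r ler_wiXn2l// ltW.
case: n nq => [|n] nq; first by rewrite mul_coef0// absE0// mul0r exprn_ge0.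
rewrite -(prednK (ltnW q_gt1)) [leRHS]exprSr; apply: ler_pM; rewrite ?(abs_ge0 Habs) ?exprn_ge0//.
  apply: le_trans (alow nq) _; apply: le_trans ws _.
  by apply: lerXn2r; rewrite ?nnegrE// ltW.
by apply: ler_iXnr => //; exact: ltW.
Qed.

(** Torsion points of the disc of radius s0 are killed by p^t, so [p^j](x) stays outside it for j <=
    n - t. Each of the first n - t multiplications by p thus takes an absolute value a to at most
    a^q. *)
Lemma exact_order_size s0 t n x : 0 < s0 -> w <= s0 ^+ q.-1 ->
  (forall y, tors y -> abs y <= s0 -> (p ^ t) <.> y = 0) ->
  abs x < 1 -> (p ^ n.+1) <.> x = 0 -> (p ^ n) <.> x <> 0 -> (t <= n)%N ->
  s0 <= abs x ^+ (q ^ (n - t)).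
Proof.
move=> s00 ws ht x1 xn1 xn tn; have tx := pow_tors x1 xn1.
have big j : (j <= n - t)%N -> s0 < abs ((p ^ j) <.> x).
  move=> jn; case: ltP => // le; case: xn.
  have -> : n = (n - t - j + (t + j))%N by lia.
  rewrite mul_pD// mul_pD// ht ?fg_mul0//; exact: tors_mul.
apply: le_trans (ltW (big (n - t)%N (leqnn _))) _.
have : (n - t <= n - t)%N by [].
move: {1 3 4}(n - t)%N => j; elim: j => [|j ih] jn.
  by rewrite !expn0 expr1; exact: fg_mul_le.
rewrite mul_pS// expnSr exprM.
apply: le_trans (abs_mulp_above s00 ws (abs_mul_lt1 _ x1) (big _ (ltnW jn))) _.
by apply: lerXn2r; rewrite ?nnegrE ?exprn_ge0 ?(abs_ge0 Habs)// ih// ltnW.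
Qed.

End Height.
End Torsion.

(** * Common torsion points *)

Lemma pigeonhole_infinite (T : eqType) (L : seq T) (Q : nat -> T -> Prop) :
  (forall N, exists n x, [/\ (N <= n)%N, x \in L & Q n x]) ->
  exists x, forall N, exists2 n, (N <= n)%N & Q n x.
Proof.
elim: L => [|a L ih] hQ; first by have [n [x []]] := hQ 0%N.
case: (pselect (forall N, exists2 n, (N <= n)%N & Q n a)) => [h|]; first by exists a.
move=> /existsNP[N0 no]; apply: ih => N.
have [n [x [nN]]] := hQ (maxn N0 N); rewrite inE => /orP[/eqP ->|xL] q.
  by case: no; exists n => //; apply: leq_trans nN; exact: leq_maxl.
by exists n, x; split=> //; apply: leq_trans nN; exact: leq_maxr.
Qed.

Lemma infinite_uniq_seq (T : eqType) (A : set T) :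
  (forall s : seq T, exists2 x, A x & x \notin s) ->
  forall n, exists s : seq T, [/\ uniq s, size s = n & forall x, x \in s -> A x].
Proof.
move=> inf; elim=> [|n [s [us ss hs]]]; first by exists [::].
have [x Ax xs] := inf s; exists (x :: s); rewrite /= xs us ss; split=> // y.
by rewrite inE => /orP[/eqP->|/hs].
Qed.

Section CommonTorsion.
Variables (R : realType) (C : fieldType) (abs : C -> R).
Hypothesis Habs : is_nonarch_abs abs.
Hypothesis Hcomp : abs_complete abs.
Variables (Kbar : closedFieldType) (h : {rmorphism Kbar -> C}).
Hypothesis h_dense : forall (z : C) (e : R), 0 < e -> exists x : Kbar, abs (z - h x) < e.
Variables (K1 : fieldType) (i : {rmorphism K1 -> C}) (w : R).
Hypothesis i_lim : forall u l, (forall n, range i (u n)) -> abs_cvg abs u l -> range i l.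
Hypothesis w0 : 0 < w.
Hypothesis w1 : w < 1.
Hypothesis gap : forall x : K1, abs (i x) < 1 -> abs (i x) <= w.
Variable p : nat.
Hypothesis p_prime : prime p.
Hypothesis p_lt1 : abs p%:R < 1.
Hypothesis p_neq0 : p%:R != 0 :> C.
Hypothesis abs_coprime : forall n, coprime p n -> abs n%:R = 1.

Local Notation fmul F n x := (fg_mul (fun z : C => z) abs F n x).

Lemma char0_of_abs n : (0 < n)%N -> n%:R != 0 :> C.
Proof.
move=> n0; have [m pm ->] := pfactor_coprime p_prime n0.
rewrite natrM mulf_neq0 ?natrX ?expf_neq0//.
by rewrite -(abs_gt0 Habs) abs_coprime// ltr01.
Qed.

Section OneGroup.
Variable F : series2 C.
Hypothesis F_int : integral2 abs F.
Hypothesis F_fgl : is_formal_group_law F.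
Hypothesis F_in : forall k l, range i (F k l).

(** The inverse of a torsion point is one of its multiples, so subtraction requires no inverse
    series. *)
Lemma tors_neg n x : abs x < 1 -> (0 < n)%N -> fmul F n x = 0 ->
  fev abs F x (fmul F n.-1 x) = 0.
Proof. by move=> x1 n0 e; rewrite -e -[in RHS](prednK n0). Qed.

Lemma mul_p_le m n x : abs x < 1 -> (m <= n)%N -> fmul F (p ^ m) x = 0 -> fmul F (p ^ n) x = 0.
Proof.
move=> x1 mn e; rewrite -(subnK mn) (mul_pD Habs Hcomp p F_int F_fgl)// e.
exact: fg_mul0.
Qed.

Lemma tors_seq_bound (s : seq C) : exists e, forall x, x \in s -> tors abs F x -> fmul F (p ^ e) x = 0.
Proof.
elim: s => [|x s [e he]]; first by exists 0%N.
have [e' he'] : exists e', tors abs F x -> fmul F (p ^ e') x = 0.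
  case: (pselect (tors abs F x)) => [tx|]; last by exists 0%N.
  by have [n hn] := tors_p Habs Hcomp p_prime abs_coprime F_int F_fgl tx; exists n.
exists (maxn e e') => y; rewrite inE => /orP[/eqP ->|ys] ty;
  apply: (mul_p_le (tors_lt1 ty)); first exact: leq_maxr; first exact: he'.
  exact: leq_maxl.
exact: he.
Qed.

Lemma tors_poly x : tors abs F x -> exists2 P : {poly K1}, P \is monic & root (map_poly i P) x.
Proof.
move=> tx; have x1 := tors_lt1 tx.
have [n hn] := tors_p Habs Hcomp p_prime abs_coprime F_int F_fgl tx.
have [P [mP _ _ zP]] := series_poly Habs Hcomp i_lim w0 w1 gap (mul_coef_pow_range p F_in n)
  (mul_coef_pow_int Habs p F_int n) (mul_coef_pow_neq0 p_neq0 F_fgl n).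
by exists P => //; apply/(zP x x1); rewrite -(fg_mul_sev Habs Hcomp F_int F_fgl).
Qed.

Lemma integral1_row u : abs u < 1 -> integral1 abs (fun j => sev abs (F j) u).
Proof.
move=> u1 j; apply: abs_sev_le => // n.
by apply: absM_le1 => //; apply: absX_le1 => //; exact: ltW.
Qed.

Lemma sev_row0 u : abs u < 1 -> sev abs (F 0%N) u = u.
Proof.
move=> u1; have a0 : abs 0 < 1 by rewrite absE0.
rewrite -(sev_at0 Habs (integral1_row u1)) -(fev_sev Habs Hcomp F_int)//.
by rewrite fevC// fev0.
Qed.

Lemma row_span j u N : exists a : {poly K1}, \sum_(k < N) F j k * u ^+ k = (map_poly i a).[u].
Proof.
have [g hg] : exists g : nat -> K1, forall k, i (g k) = F j k.
  suff /choice[g hg] : forall k, exists a, i a = F j k by exists g.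
  by move=> k; have [a _ <-] := F_in j k; exists a.
exists (\poly_(k < N) g k).
rewrite (@horner_coef_wide _ N); last first.
  by rewrite size_map_poly size_poly.
by apply: eq_bigr => k _; rewrite coef_map coef_poly ltn_ord; congr (_ * _); exact/esym/hg.
Qed.

End OneGroup.

Variables F G : series2 C.
Hypothesis F_int : integral2 abs F.
Hypothesis F_fgl : is_formal_group_law F.
Hypothesis F_in : forall k l, range i (F k l).
Hypothesis G_int : integral2 abs G.
Hypothesis G_fgl : is_formal_group_law G.
Hypothesis G_in : forall k l, range i (G k l).

(* F(Y, u) - G(Y, v) is a series in Y with infinitely many zeros. *)
Lemma same_translation u v : tors abs F u -> tors abs G v ->
  (forall s : seq C, exists z, [/\ z \notin s, abs z < 1 & fev abs F z u = fev abs G z v]) ->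
  u = v /\ forall j, sev abs (F j) u = sev abs (G j) v.
Proof.
move=> tu tv inf; have u1 := tors_lt1 tu; have v1 := tors_lt1 tv.
have [P mP Pu] := tors_poly F_int F_fgl F_in tu.
have [Q mQ Qv] := tors_poly G_int G_fgl G_in tv.
have Fr := integral1_row F_int u1; have Gr := integral1_row G_int v1.
suff e j : sev abs (F j) u = sev abs (G j) v.
  by split=> //; rewrite -(sev_row0 F_int F_fgl u1) e sev_row0.
apply/eqP; rewrite -subr_eq0; apply/eqP.
apply: (series_eq0 Habs Hcomp h_dense w0 w1 gap (f := fun j => sev abs (F j) u - sev abs (G j) v)
  (dim_le_span mP mQ Pu Qv)).
(* The partial sums of each coefficient lie in K1[u] + K1[v]; the coefficient itself is only a limit
   of them. *)
- move=> m e e0; pose r := Num.max (abs u) (abs v).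
  have r1 : r < 1 by rewrite /r gt_max u1.
  have [ur vr] : abs u <= r /\ abs v <= r by rewrite /r !le_max !lexx orbT.
  have [N hN] := exp_small (le_trans (abs_ge0 Habs u) ur) r1 e0.
  have [a ea] := row_span F_in m u N; have [b eb] := row_span G_in m v N.
  exists ((map_poly i a).[u] + (map_poly i (- b)).[v]); first by exists a, (- b).
  rewrite rmorphN hornerN -ea -eb; apply: le_lt_trans hN.
  have -> (a' b' c' d' : C) : a' - b' - (c' - d') = (a' - c') - (b' - d') by ring.
  by apply: absB_le => //; apply: sev_approx.
- by move=> m; apply: absB_le.
- move=> s; have [z [zs z1 e]] := inf s; exists z; split=> //.
  by rewrite sevB// -!(fev_sev Habs Hcomp)// e subrr.
Qed.

Lemma eq_of_rows : (forall s : seq C, exists u, [/\ u \notin s, abs u < 1 &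
    forall j, sev abs (F j) u = sev abs (G j) u]) -> forall j k, F j k = G j k.
Proof.
move=> inf j k; apply/eqP; rewrite -subr_eq0; apply/eqP.
apply: (series_eq0 Habs Hcomp h_dense w0 w1 gap (f := fun k => F j k - G j k) (@range_dim_le _ _ i)).
- move=> m; apply/sub_tclosure => //; have [a _ <-] := F_in j m; have [b _ <-] := G_in j m.
  by exists (a - b); rewrite ?rmorphB.
- by move=> m; apply: absB_le.
move=> s; have [u [us u1 e]] := inf s; exists u; split=> //.
by rewrite sevB ?e ?subrr.
Qed.

Hypothesis common_infinite : forall s : seq C, exists x, [/\ tors abs F x, tors abs G x & x \notin s].

(** F[p^N] is finite, so some common torsion point has exact F-order p^m with m > N. Take n = m - 1
    and its conjugates over K1. *)
Lemma common_orbit N : exists n rs, [/\ (N <= n)%N, uniq rs,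
  forall o, o \in rs -> [/\ abs o < 1, fmul F (p ^ n.+1) o = 0, fmul F (p ^ n) o <> 0 & tors abs G o]
  & \prod_(o <- rs) abs o <= w].
Proof.
have [s hs] := pow_tors_finite Habs Hcomp h_dense w0 w1 gap p_neq0 F_int F_fgl F_in N.
have [z [Fz Gz zs]] := common_infinite s; have z1 := tors_lt1 Fz.
have [k hk] := tors_p Habs Hcomp p_prime abs_coprime F_int F_fgl Fz.
have ex : exists k, fmul F (p ^ k) z == 0 by exists k; apply/eqP.
have [m /eqP hm min] := ex_minnP ex.
have Nm : (N < m)%N.
  case: ltnP => // mN; case/negP: zs; apply: hs => //.
  exact: mul_p_le hm.
have m0 : (0 < m)%N by exact: leq_ltn_trans Nm.
have [l hl] := tors_p Habs Hcomp p_prime abs_coprime G_int G_fgl Gz.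
have [|||rs [urs rsP prs]] := conjugate_zeros Habs Hcomp h_dense i_lim w0 w1 gap char0_of_abs
  (mul_coef_pow_range p F_in m.-1.+1) (mul_coef_pow_int Habs p F_int m.-1.+1)
  (mul_coef_pow_neq0 p_neq0 F_fgl m.-1.+1)
  (mul_coef_pow_range p G_in l) (mul_coef_pow_int Habs p G_int l)
  (mul_coef_pow_neq0 p_neq0 G_fgl l)
  (mul_coef_pow_range p F_in m.-1) (mul_coef_pow_int Habs p F_int m.-1)
  (mul_coef_pow_neq0 p_neq0 F_fgl m.-1) z1.
- by rewrite -fg_mul_sev// prednK.
- by rewrite -fg_mul_sev.
- rewrite -fg_mul_sev// => /eqP /min.
  by rewrite leqNgt prednK// leqnn.
exists m.-1, rs; split=> //; first by rewrite -ltnS prednK.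
move=> o /rsP[o1]; rewrite -!fg_mul_sev// => h1 h2 h3; split=> //.
exact: (pow_tors p_prime o1 h2).
Qed.

(** The witness is u = t -_F t', where the inverse of t' is [p^e - 1](t'). *)
Lemma translate_back e x y t t' : abs x < 1 -> abs y < 1 -> abs t < 1 -> abs t' < 1 ->
  fmul F (p ^ e) t = 0 -> fmul F (p ^ e) t' = 0 -> fev abs F x t = fev abs F y t' ->
  exists u, [/\ abs u < 1, fmul F (p ^ e) u = 0 & fev abs F x u = y].
Proof.
move=> x1 y1 t1 t'1 et et' exy; pose t'' := fmul F (p ^ e).-1 t'.
have t''1 : abs t'' < 1 by exact: fg_mul_lt1.
exists (fev abs F t t''); split; first exact: fev_lt1.
  rewrite fg_mul_fev// et /t'' -fg_mulM// mulnC fg_mulM// et' fg_mul0//.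
  by rewrite fev0.
rewrite -fevA// exy fevA// tors_neg ?fev0//.
by rewrite expn_gt0 prime_gt0.
Qed.

(* Double counting of the map (o, t) |-> o +_F t from O x F[p^e] to F[p^(n+1)],
   where O is an orbit of size at least q^(n-t) / A: a large fiber consists of
   points of O which differ by elements of F[p^e]. *)
Lemma close_pairs (vs : seq C) : exists e, forall N, exists n z u,
  [/\ (N <= n)%N,
    [/\ abs z < 1, fmul F (p ^ n.+1) z = 0, fmul F (p ^ n) z <> 0 & tors abs G z],
    [/\ abs u < 1, fmul F (p ^ e) u = 0 & u \notin vs]
  & tors abs G (fev abs F z u)].
Proof.
have Finf : tors_infinite abs F.
  by move=> s; have [x [Fx _ xs]] := common_infinite s; exists x.
have [q [q1 aq alow]] := finite_height Habs Hcomp h_dense w0 w1 gap p_prime p_lt1 p_neq0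
  abs_coprime F_int F_fgl F_in Finf.
have [s0 [s00 s01 ws]] := exists_radius w0 w1 q1.
have [t ht] := tors_ball Habs Hcomp p_prime p_lt1 p_neq0 abs_coprime F_int F_fgl s01.
(* A converts sizes into cardinals: w^(A D) <= s0^D <= w^(q^(n-t)) gives q^(n-t) <= A D for D
   conjugates. *)
have [A hA] := exp_small (ltW w0) w1 s00.
(* D K pairs have at most q^(n+1) <= A D q^(t+1) sums, so K > |vs| A q^(t+1) forces a sum with more
   than |vs| preimages. *)
pose K := (size vs * A * q ^ t.+1).+1.
have [ts [uts sts hts]] := infinite_uniq_seq Finf K.
have [e he] := tors_seq_bound F_int F_fgl ts.
have ets x : x \in ts -> abs x < 1 /\ fmul F (p ^ e) x = 0.
  by move=> xts; split; [exact: tors_lt1 (hts x xts)|apply: he => //; exact: hts].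
(* e depends on [ts] only, not on N. Then n >= e puts all sums in F[p^(n+1)], and n >= t is required
   by the size estimate. *)
exists e => N; have [n [rs [nN urs rsP prs]]] := common_orbit (maxn N (maxn t e)).
have tn : (t <= n)%N by apply: leq_trans nN; rewrite !leq_max leqnn orbT.
have en : (e <= n)%N by apply: leq_trans nN; rewrite !leq_max leqnn !orbT.
have {}nN : (N <= n)%N by apply: leq_trans nN; rewrite leq_maxl.
pose D := size rs.
have D_big : (q ^ (n - t) <= A * D)%N.
  have h1 : s0 ^+ D <= w ^+ (q ^ (n - t)).
    apply: (@le_trans _ _ (\prod_(o <- rs) abs o ^+ (q ^ (n - t)))).
      have : forall o, o \in rs -> s0 <= abs o ^+ (q ^ (n - t)).
        move=> o /rsP[o1 h1 h2 _].
        exact: (exact_order_size Habs Hcomp w0 w1 p_prime p_lt1 p_neq0 abs_coprime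
                  F_int F_fgl q1 alow s00 ws ht).
      rewrite /D; elim: rs {urs rsP prs D} => [|o rs ih] hrs.
        by rewrite big_nil expr0.
      rewrite big_cons exprS ler_pM ?exprn_ge0 ?(ltW s00)//.
        by apply: hrs; rewrite mem_head.
      by apply: ih => o' o'in; apply: hrs; rewrite inE o'in orbT.
    rewrite prodrXl; apply: lerXn2r => //; rewrite nnegrE ?(ltW w0)//.
    by apply: prodr_ge0 => o _; exact: abs_ge0.
  rewrite -(ler_iXn2l w0 w1); apply: le_trans h1; rewrite exprM.
  by apply: lerXn2r; rewrite ?nnegrE ?exprn_ge0 ?ltW.
have D0 : (0 < D)%N.
  rewrite /D lt0n size_eq0; apply: contraTneq prs => ->.
  by rewrite big_nil -ltNge.
pose g (ot : C * C) := fev abs F ot.1 ot.2.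
pose prs' := [seq (o, t') | o <- rs, t' <- ts].
have uprs : uniq prs' by apply: allpairs_uniq => // -[? ?] [? ?].
have prsP ot : ot \in prs' -> [/\ ot.1 \in rs, ot.2 \in ts, abs ot.1 < 1 & abs ot.2 < 1].
  by case/allpairsP => -[o t'] /= [ors t'ts ->] /=; have [] := rsP o ors; have [] := ets t' t'ts.
pose img := undup (map g prs').
have img_le : (size img <= q ^ n.+1)%N.
  apply: (pow_tors_count Habs Hcomp w1 F_int F_fgl q1 aq alow); first exact: undup_uniq.
  move=> x; rewrite mem_undup => /mapP[ot /prsP[o1 t1 ao at'] ->]; rewrite /g.
  split; first exact: fev_lt1.
  have [_ ho _ _] := rsP _ o1; have [_ ht'] := ets _ t1.
  rewrite fg_mul_fev// ho fevC// fev0//; apply: (mul_p_le F_int F_fgl at') ht'.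
  exact: leq_trans en _.
have [x ximg xbig] : exists2 x, x \in img & (size vs < count (fun ot => g ot == x) prs')%N.
  case: (pselect (exists2 x, x \in img & (size vs < count (fun ot => g ot == x) prs')%N)) => // no.
  have : (size prs' <= size vs * size img)%N.
    apply: (@fiber_size _ _ g) => [ot otin|x ximg]; first by rewrite mem_undup map_f.
    by case: leqP => // lt; case: no; exists x.
  rewrite size_allpairs sts -/D => le1.
  have : (D * K <= D * (size vs * A * q ^ t.+1))%N.
    apply: leq_trans le1 _; apply: leq_trans (leq_mul (leqnn _) img_le) _.
    rewrite -[n.+1](_ : (n - t + t.+1 = n.+1)%N); last by rewrite addnS subnK.
    rewrite expnD; apply: leq_trans (_ : size vs * (A * D * q ^ t.+1) <= _)%N; last first.
      by rewrite (mulnC A) -!mulnA mulnCA.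
    by rewrite leq_mul2l leq_mul2r D_big !orbT.
  by rewrite leq_pmul2l// ltnn.
pose fl := [seq ot <- prs' | g ot == x].
have flP ot : ot \in fl -> ot \in prs' /\ g ot = x by rewrite mem_filter => /andP[/eqP].
have ufl : uniq fl by exact: filter_uniq.
have sfl : (size vs < size fl)%N by rewrite size_filter.
case efl : fl => [|ot1 fl']; first by rewrite efl in sfl.
have ot1in : ot1 \in fl by rewrite efl mem_head.
have [ot1p gx1] := flP _ ot1in; have [o1in t1in o11 t11] := prsP _ ot1p.
(* The first components in the fiber are compared with that of its head [ot1]. Distinct pairs give
   distinct differences u, so there are more than |vs| of these. *)
have back ot : exists u, ot \in fl ->
    [/\ abs u < 1, fmul F (p ^ e) u = 0 & fev abs F ot1.1 u = ot.1].
  case: (boolP (ot \in fl)) => [otin|_]; last by exists 0.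
  have [otp gx] := flP _ otin; have [oin tin o_1 t_1] := prsP _ otp.
  have [//|u hu] := @translate_back e ot1.1 ot.1 ot1.2 ot.2 o11 o_1 t11 t_1
    (ets _ t1in).2 (ets _ tin).2; first by rewrite -/(g ot1) -/(g ot) gx gx1.
  by exists u.
have [b hb] := choice back.
have ub : uniq (map b fl).
  rewrite map_inj_in_uniq// => ot ot' otin ot'in eb.
  have [_ _ e1] := hb _ otin; have [_ _ e2] := hb _ ot'in.
  have e12 : ot.1 = ot'.1 by rewrite -e1 -e2 eb.
  have [otp gx] := flP _ otin; have [_ tin o_1 t_1] := prsP _ otp.
  have [ot'p gx'] := flP _ ot'in; have [_ t'in o'_1 t'_1] := prsP _ ot'p.
  have : ot.2 = ot'.2.
    apply: (fev_inj Habs Hcomp F_int F_fgl o_1 t_1 t'_1).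
    by rewrite -/(g ot) gx -gx' /g e12.
  by move: e12; clear; case: ot ot' => a b [a' b'] /= -> ->.
have [u uin uvs] : exists2 u, u \in map b fl & u \notin vs.
  case: (pselect (exists2 u, u \in map b fl & u \notin vs)) => // no.
  have : (size (map b fl) <= size vs)%N.
    apply: uniq_leq_size => // u uin; apply/negPn/negP => uvs; by case: no; exists u.
  by rewrite size_map leqNgt sfl.
have [ot otin eu] := mapP uin; have [u1 ue eo] := hb _ otin.
have [otp _] := flP _ otin; have [oin _ _ _] := prsP _ otp.
have [_ h1 h2 h3] := rsP _ o1in; have [_ _ _ h4] := rsP _ oin.
exists n, ot1.1, u; rewrite eu; split=> //; first by split; rewrite // -eu.
by rewrite eo.
Qed.

Theorem common_torsion_eq j k : F j k = G j k.
Proof.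
apply: eq_of_rows => {j k} vs.
pose Same u := abs u < 1 /\ forall j, sev abs (F j) u = sev abs (G j) u.
(* In the second case, the u that [close_pairs] provides outside of [vs] contradicts [no]. *)
case: (pselect (exists2 u, u \notin vs & Same u)) => [[u us [u1 hu]]|no]; first by exists u.
have [e he] := close_pairs vs.
have [us hus] := pow_tors_finite Habs Hcomp h_dense w0 w1 gap p_neq0 F_int F_fgl F_in e.
(* The list [us] may contain more than F[p^e], hence the condition |u| < 1. As |v| = |u|, the radius
   r also confines v to a finite set. *)
have [r r1 hr] : exists2 r, r < 1 & forall u, u \in us -> abs u < 1 -> abs u <= r.
  elim: us {hus} => [|u us [r r1 hr]]; first by exists 0; rewrite ?ltr01.
  case: (ltP (abs u) 1) => [u1|u1].
    exists (Num.max r (abs u)); first by rewrite gt_max r1.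
    by move=> v; rewrite inE le_max => /orP[/eqP->|/hr h' /h' ->//]; rewrite lexx orbT.
  exists r => // v; rewrite inE => /orP[/eqP->|]; last exact: hr.
  by rewrite ltNge u1.
have [ws hws] := tors_ball_finite Habs Hcomp h_dense w0 w1 gap p_prime p_lt1 p_neq0 abs_coprime
  G_int G_fgl G_in r1.
pose Q n (uv : C * C) := exists z,
  [/\ [/\ abs z < 1, fmul F (p ^ n.+1) z = 0 & fmul F (p ^ n) z <> 0],
      [/\ abs uv.1 < 1, fmul F (p ^ e) uv.1 = 0 & uv.1 \notin vs], tors abs G uv.2
    & fev abs F z uv.1 = fev abs G z uv.2].
have [[u v] huv] : exists uv, forall N, exists2 n, (N <= n)%N & Q n uv.
  apply: (@pigeonhole_infinite _ [seq (u, v) | u <- us, v <- ws]) => N.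
  have [n [z [u [nN [z1 hz1 hz2 Gz] [u1 hu uvs] Go]]]] := he N.
  set o := fev abs F z u in Go; have o1 := tors_lt1 Go.
  have [m [m0 hm]] := Gz.2.
  (* v = o -_G z, with [m - 1]_G(z) as the inverse of z. *)
  pose v := fev abs G (fmul G m.-1 z) o.
  have zn1 : abs (fmul G m.-1 z) < 1 by exact: fg_mul_lt1.
  have v1 : abs v < 1 by exact: (fev_lt1 Habs Hcomp G_int G_fgl).
  have zv : fev abs G z v = o.
    by rewrite /v -fevA// tors_neg// fevC// fev0.
  have Gv : tors abs G v.
    have [l hl] := tors_p Habs Hcomp p_prime abs_coprime G_int G_fgl Go.
    have [l' hl'] := tors_p Habs Hcomp p_prime abs_coprime G_int G_fgl Gz.
    apply: (@pow_tors _ _ _ _ p_prime _ (l + l')%N) => //.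
    rewrite fg_mul_fev// -fg_mulM// mulnC fg_mulM//.
    rewrite (mul_p_le G_int G_fgl z1 (leq_addl l l') hl') fg_mul0//.
    by rewrite (mul_p_le G_int G_fgl o1 (leq_addr l' l) hl) fev0.
  (* Translation by z is an isometry for both groups: |v| and |u| are both the distance from o to
     z. *)
  have av : abs v = abs u.
    have a0 : abs 0 < 1 by rewrite absE0.
    have := fevB Habs Hcomp G_int G_fgl z1 v1 a0.
    have := fevB Habs Hcomp F_int F_fgl z1 u1 a0.
    by rewrite !fev0// zv !subr0 => -> ->.
  exists n, (u, v); split=> //; last by exists z; split; rewrite //= zv.
  apply: allpairs_f; first exact: hus.
  by apply: hws => //; rewrite av; apply: hr => //; exact: hus.
have [n0 _ [_ [_ /= [u1 hu uvs] Gv _]]] := huv 0%N.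
have Fu : tors abs F u by exact: (pow_tors p_prime u1 hu).
have [|euv hs] := same_translation Fu Gv; last first.
  case: no; exists u => //; split=> // j; by rewrite hs -euv.
(* One p^N kills all F-torsion points of the list s, so a point z of exact order p^(n+1) with n >= N
   is not in it. *)
move=> s; have [N hN] := tors_seq_bound F_int F_fgl s.
have [n Nn [z [[z1 hz1 hz2] _ _ ez]]] := huv N.
exists z; split=> //; apply/negP => zs; apply: hz2.
apply: (mul_p_le F_int F_fgl z1 Nn); apply: hN => //.
exact: (pow_tors p_prime z1 hz1).
Qed.

End CommonTorsion.

(** * The p-adic field K *)

Section MapSeries.
Variables (A B : comNzRingType) (e : {rmorphism A -> B}).

Lemma map_mul3 (u v : series3 A) a b c :
  e (mul3 u v a b c) = mul3 (fun i j k => e (u i j k)) (fun i j k => e (v i j k)) a b c.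
Proof. by rewrite /mul3; do 3! (rewrite rmorph_sum; apply: eq_bigr => ? _); rewrite rmorphM. Qed.

Lemma map_exp3 (u : series3 A) n a b c :
  e (exp3 u n a b c) = exp3 (fun i j k => e (u i j k)) n a b c.
Proof.
elim: n a b c => [|n ih] a b c; first by rewrite /exp3/= /one3 rmorph_nat.
rewrite /exp3 /= map_mul3; congr (mul3 _ _ a b c).
by apply/funext => i; apply/funext => j; apply/funext => k; exact: ih.
Qed.

Lemma map_subst3 (F : series2 A) (u v : series3 A) a b c :
  e (subst3 F u v a b c) =
  subst3 (fun i j => e (F i j)) (fun i j k => e (u i j k)) (fun i j k => e (v i j k)) a b c.
Proof.
rewrite /subst3; do 2! (rewrite rmorph_sum; apply: eq_bigr => ? _).
rewrite rmorphM map_mul3; congr (_ * mul3 _ _ a b c);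
  by apply/funext => i; apply/funext => j; apply/funext => k; exact: map_exp3.
Qed.

Lemma map_formal_group_law (F : series2 A) : is_formal_group_law F ->
  is_formal_group_law (fun i j => e (F i j)).
Proof.
case=> FX FY Fc Fa; split=> [i|j|i j|a b c].
- by rewrite FX rmorph_nat.
- by rewrite FY rmorph_nat.
- by rewrite Fc.
have := congr1 e (Fa a b c); rewrite !map_subst3.
have eX : (fun i j k => e (serX A i j k)) = serX B.
  by do 3! apply/funext => ?; rewrite /serX rmorph_nat.
have eZ : (fun i j k => e (serZ A i j k)) = serZ B.
  by do 3! apply/funext => ?; rewrite /serZ rmorph_nat.
have eXY : (fun i j k => e (inXY F i j k)) = inXY (fun i j => e (F i j)).
  by do 3! apply/funext => ?; rewrite /inXY rmorphMn.
have eYZ : (fun i j k => e (inYZ F i j k)) = inYZ (fun i j => e (F i j)).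
  by do 3! apply/funext => ?; rewrite /inYZ rmorphMn.
by rewrite eX eZ eXY eYZ.
Qed.

End MapSeries.

(** * The residue map of the Witt vectors *)

Lemma witt_evalD (k : fieldType) n (x y : nat -> k) (P Q : witt_poly n) :
  witt_eval x y (P + Q) = witt_eval x y P + witt_eval x y Q.
Proof. exact: mpoly.mmapD. Qed.

Lemma witt_evalM (k : fieldType) n (x y : nat -> k) (P Q : witt_poly n) :
  witt_eval x y (P * Q) = witt_eval x y P * witt_eval x y Q.
Proof.
exact: (fst (mpoly.mmap_is_multiplicative _ (intmul 1 : {rmorphism int -> k}))).
Qed.

Lemma witt_evalX (k : fieldType) n (x y : nat -> k) i :
  witt_eval x y (wittX n i) = x (inord i : 'I_n.+1).
Proof. by rewrite /witt_eval /wittX mpoly.mmapX mpoly.mmap1U (unsplitK (inl _)). Qed.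

Lemma witt_evalY (k : fieldType) n (x y : nat -> k) i :
  witt_eval x y (wittY n i) = y (inord i : 'I_n.+1).
Proof. by rewrite /witt_eval /wittY mpoly.mmapX mpoly.mmap1U (unsplitK (inr _)). Qed.

(* The zeroth Witt coordinate is a ring morphism onto k, where p vanishes. *)
Lemma witt_p_not_unit (p : nat) (k : fieldType) (W : comNzRingType) (c : W -> nat -> k) :
  p \in [pchar k] -> is_witt_ring p c -> ~ exists v : W, 1 = p%:R * v.
Proof.
move=> pk [c_bij cD cM].
have gh0 (A : comNzRingType) (x : nat -> A) : ghost p x 0 = x 0%N.
  by rewrite /ghost big_ord1 subn0 expn0 mul1r expr1.
have c0D a b : c (a + b) 0%N = c a 0%N + c b 0%N.
  have [S [/(_ 0%N isT)]] := cD 0%N a b; rewrite !gh0 => -> ->.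
  by rewrite witt_evalD witt_evalX witt_evalY !inordK.
have c0M a b : c (a * b) 0%N = c a 0%N * c b 0%N.
  have [S [/(_ 0%N isT)]] := cM 0%N a b; rewrite !gh0 => -> ->.
  by rewrite witt_evalM witt_evalX witt_evalY !inordK.
have c00 : c 0 0%N = 0 by apply: (addrI (c 0 0%N)); rewrite -c0D !addr0.
have c01 : c 1 0%N = 1.
  have [g _ gK] := c_bij; have := c0M 1 (g (fun=> 1)).
  by rewrite mul1r gK mulr1.
have c0n n : c n%:R 0%N = n%:R.
  by elim: n => [|n ih]; rewrite ?c00// -!natr1 c0D ih c01.
case=> v /(congr1 (fun a => c a 0%N)); rewrite c01 c0M c0n (pcharf0 pk) mul0r.
by move/eqP; rewrite oner_eq0.
Qed.

(** * Absolute values on W(k)[1/p] *)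

Section PadicValues.
Variables (p : nat) (R : realType) (W : comNzRingType) (C : fieldType).
Variables (f : {rmorphism W -> C}) (abs : C -> R).
Hypothesis p_prime : prime p.
Hypothesis Habs : is_nonarch_abs abs.
Hypothesis p_not_unit : ~ exists v : W, 1 = p%:R * v.
Hypothesis f_padic : forall (n : nat) (v : W),
    ~ (exists v' : W, v = p%:R * v') -> abs (f (p%:R ^+ n * v)) = p%:R ^- n.

Lemma abs_p : abs p%:R = p%:R^-1.
Proof. by have := f_padic 1 p_not_unit; rewrite mulr1 expr1 rmorph_nat. Qed.

Lemma abs_p_lt1 : abs p%:R < 1.
Proof. by rewrite abs_p invf_lt1 ?ltr0n ?prime_gt0// ltr1n prime_gt1. Qed.

Lemma p_neq0_C : p%:R != 0 :> C.
Proof. by rewrite -(abs_gt0 Habs) abs_p invr_gt0 ltr0n prime_gt0. Qed.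

(** Bezout: a n = b p + 1 has absolute value 1, whereas |a| and |n| are at most 1. *)
Lemma abs_coprime_p n : coprime p n -> abs n%:R = 1.
Proof.
move=> pn; have n0 : (0 < n)%N.
  by case: n pn => //; rewrite /coprime gcdn0 => /eqP p1; move: p_prime; rewrite p1.
case: (egcdnP p n0) => a b e _; move: e; rewrite gcdnC (eqP pn) => e.
have h1 : abs (a * n)%:R = 1.
  have bp : abs (b * p)%:R < abs 1.
    rewrite natrM abs1//; apply: le_lt_trans abs_p_lt1.
    by apply: absM_le => //; exact: abs_nat_le1.
  by rewrite e natrD mulr1n addrC (absD_dom Habs bp) abs1.
apply/eqP; rewrite eq_le abs_nat_le1//= -h1 natrM.
by apply: absM_le => //; exact: abs_nat_le1.
Qed.

(** [f_padic] with n = 0 covers the elements not divisible by p. If p divides v, it does not divide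
    1 + v, and v = (1 + v) - 1. *)
Lemma abs_f_le1 v : abs (f v) <= 1.
Proof.
have unit_le v' : ~ (exists v'' : W, v' = p%:R * v'') -> abs (f v') = 1.
  by move=> /(f_padic 0); rewrite expr0 mul1r invr1.
case: (pselect (exists v' : W, v = p%:R * v')) => [[v' ev]|/unit_le -> //].
have -> : f v = f (1 + v) - 1 by rewrite rmorphD rmorph1 addrC addKr.
apply: absB_le; rewrite ?abs1// unit_le// => -[v'' e].
by apply: p_not_unit; exists (v'' - v'); rewrite mulrBr -e ev addrK.
Qed.

Hypothesis f_inj : injective f.

(** An element divisible by every p^m would have absolute value at most |p|^m for all m, hence
    vanish; otherwise the largest exponent decides. *)
Lemma abs_f_pow v : v != 0 -> exists m, abs (f v) = p%:R ^- m.
Proof.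
move=> v0; pose T m := exists v', v = p%:R ^+ m * v'.
have p0 : 0 < abs p%:R by rewrite abs_p invr_gt0 ltr0n prime_gt0.
case: (pselect (forall m, T m)) => [all|/existsNP[m0 no]].
  case/negP: v0; apply/eqP/f_inj; rewrite rmorph0.
  apply: (abs_eq0_of_geom Habs (ltW p0) abs_p_lt1) => m.
  have [v' ->] := all m; rewrite rmorphM rmorphXn rmorph_nat.
  by rewrite (absM Habs) absX// ler_piMr ?exprn_ge0 ?(ltW p0)// abs_f_le1.
have [m [[v' ev] noS]] : exists m, T m /\ ~ T m.+1.
  elim: m0 no => [|m ih] no; first by case: no; exists v; rewrite mul1r.
  by case: (pselect (T m)) => [t|/ih//]; exists m.
exists m; rewrite ev f_padic// => -[v'' e]; apply: noS; exists v''.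
by rewrite ev e mulrA exprSr.
Qed.

Variables (K0 : fieldType) (iota : {rmorphism W -> K0}) (g : {rmorphism K0 -> C}).
Hypothesis gE : forall v, g (iota v) = f v.
Hypothesis K0_W : is_invert_p p iota.

Lemma abs_gap_K0 x : abs (g x) < 1 -> abs (g x) <= p%:R^-1.
Proof.
have [iota_inj /(_ x)[v [n ->]]] := K0_W.
have p0 : 0 < p%:R :> R by rewrite ltr0n prime_gt0.
have p1 : 1 < p%:R :> R by rewrite ltr1n prime_gt1.
rewrite rmorphM fmorphV rmorphXn rmorph_nat gE (absM Habs) absV// absX// abs_p.
case: (eqVneq v 0) => [->|/abs_f_pow[m ->]].
  by rewrite rmorph0 absE0// mul0r invr_ge0 (ltW p0).
rewrite exprVn invrK mulrC => lt.
have nm : (n < m)%N.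
  rewrite ltnNge; apply/negP => mn; move: lt; rewrite ltNge => /negP[].
  by rewrite ler_pdivlMr ?exprn_gt0// mul1r ler_weXn2l// ltW.
case: m nm {lt} => // m nm; rewrite ler_pdivrMr ?exprn_gt0// exprS mulKf ?gt_eqF//.
by rewrite ler_weXn2l// ltW.
Qed.

End PadicValues.

(* The d + 1 first powers of x are linearly dependent over K0, so that two
   terms of the relation have the same absolute value. *)
Lemma gap_extension (R : realType) (C : fieldType) (abs : C -> R) (K0 : fieldType)
  (K : fieldExtType K0) (e : {rmorphism K -> C}) (w : R) :
  is_nonarch_abs abs -> 0 < w -> w < 1 ->
  (forall x : K0, abs (e (in_alg K x)) < 1 -> abs (e (in_alg K x)) <= w) ->
  exists w', [/\ 0 < w', w' < 1 & forall x : K, abs (e x) < 1 -> abs (e x) <= w'].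
Proof.
move=> Habs w0 w1 gap; pose d := \dim {:K}.
have d0 : (0 < d)%N by exact: (adim_gt0 {:K}%AS).
(* [exists_radius] at d + 1 gives w <= w'^d, so it is enough to bound |x|^d by w. *)
have [w' [w'0 w'1 ww']] := exists_radius w0 w1 (d0 : (1 < d.+1)%N).
exists w'; split=> // x x1; have ax0 := abs_ge0 Habs (e x).
suff : abs (e x) ^+ d <= w' ^+ d by rewrite ler_pXn2r ?nnegrE// ltW.
apply: le_trans (_ : _ <= w) ww'.
pose X := [tuple x ^+ k | k < d.+1].
have /existsNP[a] : ~ (forall a : 'I_d.+1 -> K0,
    \sum_(k < d.+1) a k *: X`_k = 0 -> forall k, a k = 0).
  move/freeP/eqP => fr; have := dimvS (subvf <<X>>).
  by rewrite fr size_tuple ltnn.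
move=> /not_implyP[a0 /existsNP[m0 /eqP am0]].
have s0 : \sum_(k < d.+1) e (in_alg K (a k)) * e x ^+ k = 0.
  transitivity (e (\sum_(k < d.+1) a k *: X`_k)); last by rewrite a0 rmorph0.
  rewrite rmorph_sum; apply: eq_bigr => k _.
  have -> : X`_k = x ^+ k by rewrite -tnth_nth tnth_mktuple.
  by rewrite -[a k *: _]mulr_algl rmorphM rmorphXn.
case: (eqVneq (e x) 0) => [->|ex0].
  by rewrite absE0// expr0n gtn_eqF// ltW.
have [|k [l [kl ekl tk]]] := sum0_two_max Habs s0.
  by exists m0; rewrite mulf_neq0 ?expf_neq0// !fmorph_eq0.
have ax : 0 < abs (e x) by rewrite abs_gt0.
have tl : e (in_alg K (a l)) * e x ^+ l != 0 by rewrite -(abs_gt0 Habs) -ekl abs_gt0.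
move: tk tl; rewrite !mulf_eq0 !negb_or => /andP[ak _] /andP[al _].
have alp : 0 < abs (e (in_alg K (a l))) by rewrite abs_gt0.
have akl : abs (e (in_alg K (a k))) = abs (e (in_alg K (a l))) * abs (e x) ^+ (l - k).
  apply: (mulIf (_ : abs (e x) ^+ k != 0)); first by rewrite expf_neq0 ?gt_eqF.
  by rewrite -mulrA -exprD subnK ?(ltnW kl)// -!absX// -!(absM Habs).
have ratio : abs (e (in_alg K (a k / a l))) = abs (e x) ^+ (l - k).
  by rewrite !fmorph_div /= (absM Habs) absV// akl mulrC mulKf ?gt_eqF.
(* Here l - k <= d, and |x|^(l-k) is the absolute value of [a k / a l], an element of K0. *)
apply: le_trans (_ : _ <= abs (e x) ^+ (l - k)) _.
  apply: ler_wiXn2l => //; first exact: ltW.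
  by rewrite leq_subLR (leq_trans _ (leq_addl _ _))// -ltnS.
by rewrite -ratio; apply: gap; rewrite ratio exprn_ilt1// -lt0n subn_gt0.
Qed.

Theorem theoremA (p : nat) (p_prime : prime p)
  (k : fieldType) (k_perfect : perfect_of_char p k)
  (W : comNzRingType) (c : W -> nat -> k) (W_witt : is_witt_ring p c)
  (K0 : fieldType) (iota : {rmorphism W -> K0}) (K0_W : is_invert_p p iota)
  (K : fieldExtType K0)
  (Kbar : closedFieldType) (j : {rmorphism K -> Kbar})
  (Kbar_closure : is_algebraic_closure j)
  (R : realType) (Cp : fieldType) (h : {rmorphism Kbar -> Cp}) (abs : Cp -> R)
  (Cp_completion :
    is_padic_completion p (fun w : W => h (j (in_alg K (iota w)))) h abs)
  (F G : series2 K)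
  (F_fg : is_formal_group (fun x : K => h (j x)) abs F)
  (G_fg : is_formal_group (fun x : K => h (j x)) abs G) :
  infinite_set (Tors (fun x : K => h (j x)) abs F
                `&` Tors (fun x : K => h (j x)) abs G) ->
  F = G.
Proof.
move=> inf; case: Cp_completion => Habs padic dense Hcomp.
pose e : {rmorphism K -> Cp} := h \o j.
pose g : {rmorphism K0 -> Cp} := e \o in_alg K.
pose f : {rmorphism W -> Cp} := g \o iota.
have p_unit := witt_p_not_unit (proj1 k_perfect) W_witt.
have f_padic : forall (n : nat) (v : W), ~ (exists v' : W, v = p%:R * v') ->
    abs (f (p%:R ^+ n * v)) = p%:R ^- n by exact: padic.
have p_lt1 := abs_p_lt1 p_prime p_unit f_padic.
have p_neq0 := p_neq0_C p_prime Habs p_unit f_padic.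
have p_cop := abs_coprime_p p_prime Habs p_unit f_padic.
have f_inj : injective f by move=> x y /fmorph_inj /(proj1 K0_W).
have pinv0 : 0 < p%:R^-1 :> R by rewrite invr_gt0 ltr0n prime_gt0.
have pinv1 : p%:R^-1 < 1 :> R by rewrite invf_lt1 ?ltr0n ?prime_gt0// ltr1n prime_gt1.
have [w [w0 w1 gapK]] := gap_extension (e := e) Habs pinv0 pinv1
  (abs_gap_K0 p_prime Habs p_unit f_padic f_inj (g := g) (fun v => erefl) K0_W).
have eA : is_subring (range e) := range_subring e.
(* The Weierstrass quotient is built by limits, so its field of definition has to be closed in
   C_p. *)
have [K1 [i ei]] := subfield_exists (tclosure_subring Habs eA)
  (tclosure_inv Habs (fun x => @range_inv _ _ e x)).
have i_lim u l : (forall n, range i (u n)) -> abs_cvg abs u l -> range i l.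
  by rewrite ei; exact: tclosure_lim.
have gap (x : K1) : abs (i x) < 1 -> abs (i x) <= w.
  have [->|x0] := eqVneq (i x) 0; first by rewrite absE0// ltW.
  have : tclosure abs (range e) (i x) by rewrite -ei; exists x.
  by move=> /(tclosure_abs Habs) /(_ x0)[_ [y _ <-] <-]; exact: gapK.
have e_in y : range i (e y) by rewrite ei; apply: sub_tclosure => //; exists y.
case: F_fg G_fg => F_int F_fgl [G_int G_fgl].
have key := @common_torsion_eq R Cp abs Habs Hcomp Kbar h dense K1 i w i_lim w0 w1 gap
  p p_prime p_lt1 p_neq0 p_cop _ _ F_int (map_formal_group_law e F_fgl) (fun a b => e_in _)
  G_int (map_formal_group_law e G_fgl) (fun a b => e_in _).
apply/funext => a; apply/funext => b; apply: (fmorph_inj e).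
apply: key => s; case: (pselect (exists x, [/\ tors abs (fun a b => e (F a b)) x,
  tors abs (fun a b => e (G a b)) x & x \notin s])) => // no.
case: inf; apply: sub_finite_set (finite_seq s) => x [Fx Gx] /=.
(* [Tors] over K and [tors] of the image series agree by conversion: both only see the images of the
   coefficients in C_p. *)
by apply/negPn/negP => xs; apply: no; exists x.
Qed.
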